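(* For each integer $k\ge 2$, let $$f(k):=\begin{cases}3-\dfrac{3}{3k-1} & k \text{ even},\\[2mm] 3-\dfrac{3}{3k-2} & k \text{ odd}.\end{cases}$$ Let $k\ge 2$ be an integer and let $G$ be a graph. If $\mathrm{mad}(G)\le f(k)$, then $G$ has an $(I,F_k)$-coloring.
   Context: All graphs are finite and simple. The average degree of a graph $H$ is $2|E(H)|/|V(H)|$, and the maximum average degree $\mathrm{mad}(G)$ is the maximum of the average degree of $H$ over all (nonempty) subgraphs $H$ of $G$. An $(I,F_k)$-coloring of a graph $G$ is a partition of $V(G)$ into two sets $I$ and $F$ (possibly empty) such that $I$ is an independent set and $G[F]$ is a forest in which each component has at most $k$ vertices. *)

(* Defs.v *)
From mathcomp Require Import all_boot all_order all_algebra.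

Set Implicit Arguments.
Unset Strict Implicit.
Unset Printing Implicit Defensive.

Import Order.TTheory GRing.Theory Num.Theory.

Local Open Scope ring_scope.

Record sgraph := SGraph {
  vertex :> finType;
  adj : rel vertex;
  adj_sym : symmetric adj;
  adj_irrefl : irreflexive adj }.

Definition edges (G : sgraph) : {set {set G}} :=
  [set [set p.1; p.2] | p : G * G & adj p.1 p.2].

(* A pair H = (V(H), E(H)); arbitrary, not only induced, subgraphs. *)
Definition is_subgraph (G : sgraph) (H : {set G} * {set {set G}}) : bool :=
  (H.2 \subset edges G) && [forall e in H.2, e \subset H.1].

Definition average_degree (G : sgraph) (H : {set G} * {set {set G}}) : rat :=
  2 * #|H.2|%:R / #|H.1|%:R.

(* Average degrees are nonnegative, so taking 0 as the unit of the iterated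
   maximum does not change its value; for the null graph it gives mad = 0. *)
Definition mad (G : sgraph) : rat :=
  \big[Num.max/0]_(H : {set G} * {set {set G}} |
                   is_subgraph H && (H.1 != set0)) average_degree H.

Section Induced.
Variables (G : sgraph) (S : {set G}).

Definition induced_adj : rel {x : G | x \in S} :=
  fun x y => adj (val x) (val y).

Fact induced_sym : symmetric induced_adj.
Proof. by move=> x y; apply: adj_sym. Qed.

Fact induced_irrefl : irreflexive induced_adj.
Proof. by move=> x; apply: adj_irrefl. Qed.

Definition induced : sgraph := SGraph induced_sym induced_irrefl.

End Induced.

(* [:: x; y] with x adjacent to y satisfies ucycle, whence the length bound. *)
Definition is_forest (G : sgraph) : Prop :=
  forall c : seq G, ucycle (@adj G) c -> (size c < 3)%N.

Definition component (G : sgraph) (x : G) : {set G} :=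
  [set y | connect (@adj G) x y].

Definition independent (G : sgraph) (I : {set G}) : Prop :=
  forall x y : G, x \in I -> y \in I -> ~~ adj x y.

Definition is_IF_coloring (k : nat) (G : sgraph) (I F : {set G}) : Prop :=
  [/\ I :|: F = [set: G], [disjoint I & F], independent I,
      is_forest (induced F)
    & forall x : induced F, (#|component x| <= k)%N].

Definition has_IF_coloring (k : nat) (G : sgraph) : Prop :=
  exists I F : {set G}, is_IF_coloring k I F.

Definition f (k : nat) : rat :=
  if odd k then 3 - 3 / (3 * k%:R - 2) else 3 - 3 / (3 * k%:R - 1).

(* Main.v *)
(** The potential method, run on graphs whose vertices carry weights.  A vertex
    [x] of weight [w x] counts [(w x).+1] towards the size of its component in
    [F], as if [w x] pendant vertices of [F] hung from it, so [k <= w x] forces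
    [x] into [I].  With [E = ecost k] (which is [3k-1] for even [k] and [3k-2]
    for odd [k]) every edge costs [E], and a vertex of weight [j] contributes
    [charge j = (3E-3)/2 - cost j].  The bound [mad G <= f k] says that all
    vertex sets of the unweighted graph have nonnegative potential; the claim
    proved by induction is that potential at least [-2] everywhere suffices.

    In a minimal counterexample every proper vertex set, other than a single
    vertex forced into [I], has potential at least [(E-1)/2]: otherwise take one
    of least potential, color it with a boundary vertex made heavier, and color
    the rest with its boundary made heavier accordingly.  This gap leaves room
    to delete vertices of degree 2 and raise the weights of their neighbors, so
    a vertex of positive initial charge has degree 2 and weight [k./2 - 1].
    After these vertices have sent their charge to their neighbors, no vertex has
    positive charge while the total is at least [-2]; the structures that remain
    possible are colored directly. *)

Require Import Defs.
From mathcomp Require Import all_boot all_order all_algebra.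
From Stdlib Require Import Classical_Prop.
From mathcomp Require Import zify.

Set Implicit Arguments.
Unset Strict Implicit.
Unset Printing Implicit Defensive.

Ltac clia := clear; lia.
Ltac cnia := clear; nia.

(** * The cost of a weight *)

Section Cost.
Variable k : nat.

(* A path of two weightless degree-2 vertices between [x] and [y] has potential
   [2 * charge 0 - 3E = -3] and acts like one more unit of weight on [x], whence
   the slope 3.  The total for weight [k], which forces [I], must be [E], one or
   two less than [3k].  Saving these units at smaller weights would falsify the
   induction claim: for even [k], [cost (k/2) = 3(k/2) - 1] would give potential
   [-1] to the triangle with weights [k/2, k/2, k/2 - 1], and for odd [k] saving
   both units at [(k+1)/2] would give [-2] to the triangle with weights
   [(k+1)/2, (k+1)/2, (k-3)/2]; neither triangle has a coloring. *)
Definition cost (j : nat) : nat :=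
  let i := minn j k in
  3 * i - (k < i.*2) - (odd k && (k.+1 < i.*2)).

Definition ecost : nat := cost k.

(** For [k >= 2] the halving and the subtraction are exact: [ecost] is odd and at least 5, and no
    cost exceeds it. *)
Definition charge (j : nat) : nat := (3 * ecost.-1)./2 - cost j.

(** Replaces truncated subtractions and parity tests by linear cases, so that [lia] can decide later
    inequalities between costs. *)
Lemma costP h o j : k = h.*2 + o -> o <= 1 -> 0 < h ->
  j <= h /\ cost j = 3 * j \/
  (o = 1 /\ j = h.+1) /\ cost j = 3 * h + 2 \/
  (h + o < j /\ j <= k) /\ cost j + 1 + o = 3 * j \/
  k <= j /\ cost j + 1 + o = 3 * k.
Proof.
move=> ek o1 h0; rewrite /cost.
have -> : odd k = (o == 1) by rewrite ek oddD odd_double; case: o o1 {ek} => [|[]].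
have [jk|jk] := leqP k j.
  have -> : k < k.*2 by lia.
  by case: eqP => ? /=; case: (ltnP k.+1 k.*2) => ? /=; lia.
case: (ltnP k j.*2) => h1; case: eqP => h2; case: (ltnP k.+1 j.*2) => h3 /=; lia.
Qed.

Lemma halfP : 2 <= k -> exists h o, [/\ k = h.*2 + o, o <= 1 & 0 < h].
Proof.
move=> k2; exists k./2, (odd k); split; first by rewrite addnC odd_double_half.
  by case: odd.
by rewrite half_gt0.
Qed.

Hypothesis k2 : 2 <= k.

Lemma cost0 : cost 0 = 0. Proof. by rewrite /cost min0n /= andbF. Qed.

Lemma ecostP h o : k = h.*2 + o -> o <= 1 -> 0 < h -> ecost + 1 + o = 3 * k.
Proof. by move=> ek o1 h0; rewrite /ecost; have := costP k ek o1 h0; lia. Qed.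

Lemma cost_mono a b : a <= b -> cost a <= cost b.
Proof.
move=> ab; have [h [o [ek o1 h0]]] := halfP k2.
by have := costP a ek o1 h0; have := costP b ek o1 h0; lia.
Qed.

Lemma cost_ge a : k <= a -> cost a = ecost.
Proof.
move=> ab; have [h [o [ek o1 h0]]] := halfP k2.
by have := costP a ek o1 h0; have := ecostP ek o1 h0; lia.
Qed.

Lemma cost_le a : cost a <= ecost.
Proof.
have [/cost_ge -> //|/ltnW] := leqP k a; exact: cost_mono.
Qed.

Lemma cost_slope a n : cost (a + n) <= cost a + 3 * n.
Proof.
have [h [o [ek o1 h0]]] := halfP k2.
by have := costP a ek o1 h0; have := costP (a + n) ek o1 h0; lia.
Qed.

Lemma ecost_ge5 : 5 <= ecost.
Proof. by have [h [o [ek o1 h0]]] := halfP k2; have := ecostP ek o1 h0; lia. Qed.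

Lemma ecost_odd : odd ecost.
Proof. by have [h [o [ek o1 h0]]] := halfP k2; have := ecostP ek o1 h0; lia. Qed.

Lemma chargeE j : 2 * charge j + 2 * cost j + 3 = 3 * ecost.
Proof.
by rewrite /charge; have := cost_le j; have := ecost_ge5; have := ecost_odd; lia.
Qed.

(* Increasing one side of an edge by [i] and the other by [k - i] costs [E] in
   total, up to the slack of 2 in the induction hypothesis. *)
Lemma split_cost (p : nat) : 2 * p <= ecost.+1 ->
  exists i, [/\ i <= k, forall a, cost (a + i) <= cost a + p
    & forall a, cost (a + (k - i)) + p <= cost a + ecost.+2].
Proof.
(* The slope is at most 3, so a budget [p] buys [p %/ 3] units of weight; the rounding loses at most
   2. *)
move=> hp; exists (p %/ 3).
have [h [o [ek o1 h0]]] := halfP k2; have eE := ecostP ek o1 h0.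
have hi1 : p <= 3 * (p %/ 3) + 2 by lia.
have hi2 : 3 * (p %/ 3) <= p by lia.
move: hi1 hi2; set i := p %/ 3 => hi1 hi2.
split=> [|a|a]; first by lia.
  by have := cost_slope a i; lia.
by have := costP a ek o1 h0; have := costP (a + (k - i)) ek o1 h0; lia.
Qed.
End Cost.

(** * Sums over finite sets *)

Lemma disjoint_setD (T : finType) (A B : {set T}) : [disjoint B & A :\: B].
Proof. by rewrite disjoints_subset setCD subsetUr. Qed.

Lemma setUD (T : finType) (A B : {set T}) : B \subset A -> B :|: (A :\: B) = A.
Proof. by move=> sBA; rewrite setDE setUIr setUCr setIT; apply/setUidPr. Qed.

Lemma sum_setU (T : finType) (A B : {set T}) (f : T -> nat) :
  [disjoint A & B] ->
  \sum_(x in A :|: B) f x = \sum_(x in A) f x + \sum_(x in B) f x.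
Proof.
by move=> dAB; rewrite -bigU //=; apply: eq_bigl => x; rewrite !inE.
Qed.

Lemma leq_sum_sub (T : finType) (A B : {set T}) (f : T -> nat) :
  A \subset B -> \sum_(x in A) f x <= \sum_(x in B) f x.
Proof.
move=> sAB; rewrite [leqRHS](big_setID A) /= (setIidPr sAB); exact: leq_addr.
Qed.

Lemma sum_setU_cond (T : finType) (A B : {set T}) (P : pred T) (f : T -> nat) :
  [disjoint A & B] -> \sum_(x in A :|: B | P x) f x =
  \sum_(x in A | P x) f x + \sum_(x in B | P x) f x.
Proof. by move=> dAB; rewrite !big_mkcondr; apply: sum_setU. Qed.

Lemma leq_sum_cond (T : finType) (A : {set T}) (P Q : pred T) (f : T -> nat) :
  {in A, forall x, P x -> Q x} ->
  \sum_(x in A | P x) f x <= \sum_(x in A | Q x) f x.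
Proof.
move=> PQ; rewrite !big_mkcondr; apply: leq_sum => x xA.
by case Px: (P x) => //; rewrite (PQ x xA Px).
Qed.

Lemma sum_eq_pointwise (T : finType) (A : {set T}) (f g : T -> nat) :
  {in A, forall a, g a <= f a} -> \sum_(a in A) f a <= \sum_(a in A) g a ->
  {in A, forall a, f a = g a}.
Proof.
move=> gf; have := leqif_sum (fun a aA => leqif_eq (gf a aA)).
move=> [le eq] ge; have : [forall (a | a \in A), g a == f a].
  by rewrite -eq eqn_leq le.
by move=> /forall_inP fg a aA; apply/esym/eqP/fg.
Qed.

(** * Weighted graphs and their colorings *)

Section Potential.
Variables (T : finType) (e : rel T).
Hypotheses (e_sym : symmetric e) (e_irr : irreflexive e).
Implicit Types (A B F P R S W X Y Z : {set T}) (x y z t : T) (w : T -> nat).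

Definition deg A x : nat := \sum_(y in A) e x y.
(** Ordered adjacent pairs are counted, so [cut A A] sees each edge twice; hence the halving in
    [nedges]. *)
Definition cut A B : nat := \sum_(x in A) deg B x.
Definition nedges A : nat := (cut A A)./2.

Lemma degU A B x : [disjoint A & B] -> deg (A :|: B) x = deg A x + deg B x.
Proof. exact: sum_setU. Qed.

Lemma degD A B x : B \subset A -> deg A x = deg (A :\: B) x + deg B x.
Proof.
move=> sBA; rewrite addnC -degU; first by rewrite setUD.
exact: disjoint_setD.
Qed.

Lemma deg1 x y : deg [set x] y = e y x.
Proof. by rewrite /deg big_set1. Qed.

Lemma deg_card A x : deg A x = #|[set y in A | e x y]|.
Proof.
rewrite -sum1_card /deg big_mkcond [RHS]big_mkcond; apply: eq_bigr => y _.
by rewrite inE; case: (y \in A) => //=; case: (e x y).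
Qed.

Lemma deg_sub A B x : A \subset B -> deg A x <= deg B x.
Proof. exact: leq_sum_sub. Qed.

Lemma deg_gt0P A x : reflect (exists2 y, y \in A & e x y) (0 < deg A x).
Proof.
rewrite deg_card; apply: (iffP card_gt0P) => [[y]|[y yA xy]].
  by rewrite inE => /andP[]; exists y.
by exists y; rewrite inE yA.
Qed.

Lemma deg0 A x y : deg A x = 0 -> y \in A -> e x y = false.
Proof.
by move=> d0 yA; apply/negP => xy; have /deg_gt0P : exists2 y, y \in A & e x y;
  [exists y | rewrite d0].
Qed.

Lemma deg_le1 A x y y' : deg A x <= 1 ->
  y \in A -> y' \in A -> e x y -> e x y' -> y = y'.
Proof.
rewrite deg_card => /card_le1_eqP h yA yA' xy xy'.
by apply: h; rewrite inE ?yA ?yA'.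
Qed.

Lemma deg2P A v : deg A v = 2 -> exists x y,
  [/\ x != y, x \in A, y \in A, e v x & e v y] /\
  {in A, forall t, t != x -> t != y -> e v t = false}.
Proof.
rewrite deg_card => /eqP/cards2P[x [y [xy eA]]]; exists x, y; split.
  have : x \in [set y in A | e v y] by rewrite eA !inE eqxx.
  have : y \in [set y in A | e v y] by rewrite eA !inE eqxx orbT.
  by rewrite !inE => /andP[-> ->] /andP[-> ->].
move=> t tA tx ty; apply/negP => vt.
have : t \in [set y in A | e v y] by rewrite inE tA.
by rewrite eA !inE (negPf tx) (negPf ty).
Qed.

Lemma deg_ge2 A v x y : x != y -> x \in A -> y \in A -> e v x -> e v y ->
  2 <= deg A v.
Proof.
move=> xy xA yA vx vy; rewrite deg_card; have := cards2 x y; rewrite xy => <-.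
by apply: subset_leq_card; apply/subsetP => t /set2P[->|->]; rewrite inE ?xA ?yA.
Qed.

Lemma degD1 A x y : y \in A -> deg A x = deg (A :\ y) x + e x y.
Proof.
by move=> yA; rewrite /deg (big_setD1 y) //= addnC.
Qed.

Lemma cutC A B : cut A B = cut B A.
Proof.
rewrite /cut /deg exchange_big /=; apply: eq_bigr => y _; apply: eq_bigr => x _.
by rewrite e_sym.
Qed.

Lemma cutUl A B C : [disjoint A & B] -> cut (A :|: B) C = cut A C + cut B C.
Proof. exact: sum_setU. Qed.

Lemma cutUr A B C : [disjoint A & B] -> cut C (A :|: B) = cut C A + cut C B.
Proof. by move=> d; rewrite cutC cutUl // !(cutC C). Qed.

Lemma cut1l x B : cut [set x] B = deg B x.
Proof. by rewrite /cut big_set1. Qed.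

Lemma cut1r x B : cut B [set x] = deg B x.
Proof. by rewrite cutC cut1l. Qed.

Lemma cut_sub A A' B B' : A \subset A' -> B \subset B' -> cut A B <= cut A' B'.
Proof.
move=> sA sB; apply: leq_trans (leq_sum_sub _ sA).
by apply: leq_sum => x _; exact: deg_sub.
Qed.

(** Removing a vertex from [A] lowers [cut A A] by twice its degree, which preserves parity. *)
Lemma nedgesE A : cut A A = 2 * nedges A.
Proof.
suff h : ~~ odd (cut A A) by rewrite /nedges; lia.
elim: {A}_.+1 {-2}A (ltnSn #|A|) => // n IH A.
have [->|[x xA]] := set_0Vmem A; first by rewrite /cut big_set0.
rewrite (cardsD1 x) xA -{2 3}(setD1K xA) => hA.
have dx : [disjoint [set x] & A :\ x] by rewrite disjoints1 !inE eqxx.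
rewrite cutUl // !cutUr // !cut1l !cut1r deg1 e_irr add0n addnA addnn.
by rewrite oddD odd_double /= IH.
Qed.

Lemma nedgesU A B : [disjoint A & B] ->
  nedges (A :|: B) = nedges A + nedges B + cut A B.
Proof.
move=> d; have := nedgesE (A :|: B); rewrite cutUl // !cutUr //.
by rewrite (cutC B A) !nedgesE; lia.
Qed.

Lemma nedges0 : nedges set0 = 0.
Proof. by rewrite /nedges /cut big_set0. Qed.

Lemma nedges1 x : nedges [set x] = 0.
Proof. by rewrite /nedges cut1l deg1 e_irr. Qed.

Lemma cut_gt0P A B : reflect (exists x y, [/\ x \in A, y \in B & e x y]) (0 < cut A B).
Proof.
apply: (iffP idP) => [h|[x [y [xA yB xy]]]].
  have : [exists x in A, 0 < deg B x].
    apply: contraLR h => /exists_inPn h; rewrite -leqNgt leqn0 /cut big1 // => x xA.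
    by apply/eqP; rewrite -leqn0 leqNgt h.
  by case/exists_inP => x xA /deg_gt0P[y yB xy]; exists x, y.
rewrite /cut (bigD1 x) //=; suff : 0 < deg B x by lia.
by apply/deg_gt0P; exists y.
Qed.

Lemma nedges_indep A : {in A &, forall x y, ~~ e x y} -> nedges A = 0.
Proof.
move=> h; apply/eqP; rewrite -leqn0 leqNgt; apply/negP => n0.
have : 0 < cut A A by rewrite nedgesE //; lia.
by case/cut_gt0P => x [y [xA yA xy]]; have := h x y xA yA; rewrite xy.
Qed.

(** * Forests with components of bounded weight *)

Definition inc w z n : T -> nat := fun t => w t + n * (t == z).

Variable k : nat.

(* [sparse F] says that [F] induces a forest; the labelling [r] is constant on
   the components of [F]. *)
Definition sparse F := forall Y, Y \subset F -> Y != set0 -> nedges Y < #|Y|.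

Definition good w F := sparse F /\ exists r : T -> nat,
  (forall x y, x \in F -> y \in F -> e x y -> r x = r y) /\
  (forall x, x \in F -> \sum_(y in F | r y == r x) (w y).+1 <= k).

Lemma good_le w w' F : {in F, forall x, w x <= w' x} -> good w' F -> good w F.
Proof.
move=> h [sF [r [r1 r2]]]; split=> //; exists r; split=> // x xF.
by apply: leq_trans (r2 x xF); apply: leq_sum => y /andP[yF _]; apply: h.
Qed.

Lemma good_lt w F x : good w F -> x \in F -> w x < k.
Proof.
move=> [_ [r [_ r2]]] xF; apply: leq_trans (r2 x xF).
by rewrite (bigD1 x) /= ?xF ?eqxx // leq_addr.
Qed.

Lemma good0 w : good w set0.
Proof.
split=> [Y|]; first by rewrite subset0 => /eqP->; rewrite eqxx.
by exists (fun=> 0); split=> [x y|x]; rewrite inE.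
Qed.

Lemma good1 w x : w x < k -> good w [set x].
Proof.
move=> wx; split=> [Y|].
  by rewrite subset1 => /orP[/eqP->|/eqP->]; rewrite ?eqxx // nedges1 cards1.
exists (fun=> 0); split=> // y _.
by rewrite (eq_bigl (mem [set x])) ?big_set1 // => z; rewrite eqxx andbT.
Qed.

(** Two nonempty parts of [Y] each span fewer edges than vertices, which leaves room for one cross
    edge. *)
Lemma sparseU F1 F2 : [disjoint F1 & F2] -> cut F1 F2 <= 1 ->
  sparse F1 -> sparse F2 -> sparse (F1 :|: F2).
Proof.
move=> d c1 s1 s2 Y sY Y0.
have eY : Y = (Y :&: F1) :|: (Y :&: F2) by rewrite -setIUr; apply/esym/setIidPl.
have dY : [disjoint Y :&: F1 & Y :&: F2].
  by apply: disjointWl (disjointWr _ d); apply: subsetIr.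
have cY : cut (Y :&: F1) (Y :&: F2) <= 1.
  by apply: leq_trans c1; apply: cut_sub; apply: subsetIr.
have := s1 (Y :&: F1) (subsetIr _ _); have := s2 (Y :&: F2) (subsetIr _ _).
move=> h2 h1; suff : nedges (Y :&: F1 :|: Y :&: F2) < #|Y :&: F1 :|: Y :&: F2|.
  by rewrite -eY.
rewrite nedgesU // cardsU (disjoint_setI0 dY) cards0 subn0.
have [e1|n1] := eqVneq (Y :&: F1) set0.
  have n2 : Y :&: F2 != set0 by move: Y0; rewrite {1}eY e1 set0U.
  by rewrite e1 nedges0 cards0 /cut big_set0 addn0 !add0n; apply: h2.
have [e2|n2] := eqVneq (Y :&: F2) set0.
  by rewrite e2 cutC nedges0 cards0 /cut big_set0 !addn0; apply: h1.
by have := h1 n1; have := h2 n2; lia.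
Qed.

Lemma good_disjoint w F1 F2 : [disjoint F1 & F2] -> cut F1 F2 = 0 ->
  good w F1 -> good w F2 -> good w (F1 :|: F2).
Proof.
move=> d c0 [s1 [r1 [a1 b1]]] [s2 [r2 [a2 b2]]]; split.
  by apply: sparseU; rewrite ?c0.
have nf x : x \in F2 -> (x \in F1) = false.
  by move=> xF; apply: (disjointFl d).
have ne x y : x \in F1 -> y \in F2 -> e x y = false.
  move=> xF yF; apply: (deg0 _ yF); apply/eqP; rewrite -leqn0 -c0 -cut1l.
  by apply: cut_sub; rewrite ?sub1set.
(* Even and odd labels keep the classes of [F1] and [F2] apart. *)
exists (fun y => if y \in F1 then (r1 y).*2 else (r2 y).*2.+1); split.
  move=> x y; rewrite !inE => /orP[xF|xF] /orP[yF|yF].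
  - by rewrite xF yF => /a1->.
  - by rewrite (ne x y).
  - by rewrite e_sym (ne y x).
  - by rewrite !nf // => /a2->.
move=> x xF; rewrite sum_setU_cond //; move: xF; rewrite inE.
case xF1: (x \in F1) => /= xF.
  rewrite [X in _ + X]big1 ?addn0.
    apply: leq_trans (b1 x xF1); apply: leq_sum_cond => y yF.
    by rewrite yF; lia.
  by move=> y /andP[/nf-> /eqP]; lia.
rewrite big1 ?add0n.
  apply: leq_trans (b2 x xF); apply: leq_sum_cond => y yF.
  by rewrite nf //; lia.
by move=> y /andP[-> /eqP]; lia.
Qed.

Lemma sum_inc w F (P : pred T) z n : z \in F -> P z ->
  \sum_(y in F | P y) (inc w z n y).+1 = \sum_(y in F | P y) (w y).+1 + n.
Proof.
move=> zF Pz; rewrite (bigD1 z) ?zF //= [X in _ = X + _](bigD1 z) ?zF //=.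
rewrite /inc eqxx muln1 addnAC addSn; congr (_.+1 + _ + _).
by apply: eq_bigr => y /andP[_ /negPf->]; rewrite muln0 addn0.
Qed.

(** The class of [z] has [i] units to spare and that of [x] has [k - i], so their sizes are at most
    [k - i] and [i], and the union of the two classes still fits. *)
Lemma good_merge w F1 F2 z x i : i <= k -> [disjoint F1 & F2] ->
  z \in F1 -> x \in F2 ->
  (forall a b, a \in F1 -> b \in F2 -> e a b -> a = z /\ b = x) ->
  good (inc w z i) F1 -> good (inc w x (k - i)) F2 -> good w (F1 :|: F2).
Proof.
move=> ik d zF1 xF2 cross [s1 [r1 [a1 b1]]] [s2 [r2 [a2 b2]]]; split.
  apply: sparseU => //; rewrite /cut (bigD1 z) //= big1 ?addn0.
    rewrite deg_card -(cards1 x); apply: subset_leq_card; apply/subsetP => b.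
    by rewrite !inE => /andP[bF /(cross _ _ zF1 bF)[_ ->]].
  move=> a /andP[aF /negP az]; rewrite /deg big1 // => b bF.
  by apply/eqP; rewrite eqb0; apply/negP => /(cross _ _ aF bF)[/eqP].
have nf y : y \in F2 -> (y \in F1) = false.
  by move=> yF; apply: (disjointFl d).
(* The class of [x] takes the label of the class of [z]; parity separates all other labels. *)
pose r y := if y \in F1 then (r1 y).*2 else
  if r2 y == r2 x then (r1 z).*2 else (r2 y).*2.+1.
exists r; split.
  move=> a b; rewrite !inE /r => /orP[aF|aF] /orP[bF|bF].
  - by rewrite aF bF => /a1->.
  - by move=> /(cross _ _ aF bF)[-> ->]; rewrite zF1 nf // eqxx.
  - by rewrite e_sym => /(cross _ _ bF aF)[-> ->]; rewrite zF1 nf // eqxx.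
  - by rewrite !nf // => /a2->.
have b1' c : c \in F1 -> r1 c != r1 z ->
    \sum_(y in F1 | r1 y == r1 c) (w y).+1 <= k.
  move=> cF cz; apply: leq_trans (b1 c cF).
  by apply: leq_sum => y _; rewrite ltnS leq_addr.
have b2' c : c \in F2 -> r2 c != r2 x ->
    \sum_(y in F2 | r2 y == r2 c) (w y).+1 <= k.
  move=> cF cx; apply: leq_trans (b2 c cF).
  by apply: leq_sum => y _; rewrite ltnS leq_addr.
have bz := b1 z zF1; rewrite sum_inc // in bz.
have bx := b2 x xF2; rewrite sum_inc // in bx.
move=> c cF; rewrite sum_setU_cond //.
have [ez|nz] := eqVneq (r c) (r1 z).*2.
  have -> : k = (k - i) + i by rewrite subnK.
  apply: leq_add.
    apply: (@leq_trans (\sum_(y in F1 | r1 y == r1 z) (w y).+1)); last by lia.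
    by apply: leq_sum_cond => y yF; rewrite ez /r yF; lia.
  apply: (@leq_trans (\sum_(y in F2 | r2 y == r2 x) (w y).+1)); last by lia.
  apply: leq_sum_cond => y yF; rewrite ez /r nf //.
  by case: (eqVneq (r2 y) (r2 x)) => // _; lia.
move: cF; rewrite inE; case cF1: (c \in F1) => /= cF.
  have rc : r c = (r1 c).*2 by rewrite /r cF1.
  rewrite [X in _ + X]big1 ?addn0.
    apply: leq_trans (b1' c cF1 _); last by move: nz; rewrite rc; lia.
    apply: leq_sum_cond => y yF; rewrite rc /r yF; lia.
  move=> y /andP[yF /eqP]; move: nz; rewrite rc /r nf //.
  by case: (eqVneq (r2 y) (r2 x)) => _; lia.
have rc : r c = (r2 c).*2.+1 /\ r2 c != r2 x.
  by move: nz; rewrite /r cF1; have [_|cx] := eqVneq (r2 c) (r2 x); first lia.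
case: rc => rc rcx; rewrite big1 ?add0n.
  apply: leq_trans (b2' c cF rcx); apply: leq_sum_cond => y yF.
  by rewrite rc /r nf //; case: (eqVneq (r2 y) (r2 x)) => _; lia.
by move=> y /andP[yF /eqP]; rewrite rc /r yF; lia.
Qed.

(** The neighbor of [v] in [F] already carries the full count of [v], so [v] can be attached there
    as a pendant vertex. *)
Lemma good_add w F v : v \notin F -> w v < k -> deg F v <= 1 ->
  good (fun t => w t + (w v).+1 * e v t) F -> good w (v |: F).
Proof.
move=> vF wv d1 gF; have dv : [disjoint [set v] & F] by rewrite disjoints1.
have [d0|/deg_gt0P[z zF vz]] := posnP (deg F v).
  apply: good_disjoint => //; [by rewrite cut1l | exact: good1 |].
  by apply: good_le gF => t _; rewrite leq_addr.
have u t : t \in F -> e v t = (t == z).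
  move=> tF; apply/idP/eqP => [vt|->//]; exact: deg_le1 d1 tF zF vt vz.
rewrite setUC; apply: (@good_merge _ _ _ z v (w v).+1); rewrite ?set11 //.
- by rewrite disjoint_sym.
- by move=> a b aF; rewrite inE => /eqP-> ; rewrite e_sym u // => /eqP.
- by apply: good_le gF => t tF; rewrite /inc u.
- by apply: good1; rewrite /inc eqxx; lia.
Qed.

(** Components have at most two vertices. Vertices are removed one by one, each passing its count to
    its neighbor, which is isolated afterwards. *)
Lemma good_matching w F : {in F, forall x, w x < k} ->
  {in F, forall x, deg F x <= 1} ->
  {in F &, forall x y, e x y -> w x + w y + 2 <= k} -> good w F.
Proof.
elim: {F}_.+1 {-2}F (ltnSn #|F|) w => // n IH F.
have [->|[x xF]] := set_0Vmem F; first by move=> *; exact: good0.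
rewrite (cardsD1 x) xF => hn w w1 d1 w2; rewrite -(setD1K xF).
have sF : F :\ x \subset F by apply: subsetDl.
apply: good_add; rewrite ?inE ?eqxx //; first exact: w1.
  by apply: leq_trans (d1 x xF); apply: deg_sub.
have d0 t : t \in F :\ x -> e x t -> deg (F :\ x) t = 0.
  move=> tF xt; have := d1 t (subsetP sF _ tF).
  by rewrite (degD1 _ xF) e_sym xt; lia.
apply: IH => // [t tF|t tF|t s tF sF' ts].
- case xt : (e x t); rewrite ?muln0 ?addn0 ?w1 ?(subsetP sF) //.
  by have := w2 x t xF (subsetP sF _ tF) xt; lia.
- by apply: leq_trans (d1 t (subsetP sF _ tF)); apply: deg_sub.
- have xt : e x t = false.
    by apply/negP => xt; have := deg0 (d0 t tF xt) sF'; rewrite ts.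
  have xs : e x s = false.
    by apply/negP => xs; have := deg0 (d0 s sF' xs) tF; rewrite e_sym ts.
  by rewrite xt xs !muln0 !addn0; apply: w2; rewrite ?(subsetP sF).
Qed.
(** On a cycle of length at least 3 every vertex has two distinct neighbors, so its vertices span at
    least as many edges as there are vertices. *)
Lemma sparse_ucycle F (c : seq T) : sparse F -> {subset c <= F} ->
  ucycle e c -> size c < 3.
Proof.
move=> sF cF /andP[cyc uc]; rewrite ltnNge; apply/negP => c3.
pose Y := [set x in c].
have cardY : #|Y| = size c by rewrite cardsE; apply/card_uniqP.
have sY : Y \subset F by apply/subsetP => x; rewrite inE => /cF.
have Y0 : Y != set0 by rewrite -card_gt0 cardY; move: c3; clia.
have := sF Y sY Y0; rewrite ltnNge => /negP; apply.
have : 2 * #|Y| <= cut Y Y; last by rewrite nedgesE //; clia.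
rewrite mulnC -sum_nat_const; apply: leq_sum => x; rewrite inE => xc.
(* Rotated to start at [x], the cycle shows the two neighbors of [x] as its second and last
   entries. *)
have [i c' ec] := rot_to xc.
have : uniq (rot i c) by rewrite rot_uniq.
have : cycle e (rot i c) by rewrite rot_cycle.
have memY t : t \in rot i c -> t \in Y by rewrite mem_rot inE.
move: memY c3; rewrite -(size_rot i) ec.
case: c' {ec} => [|y [|z c']] //= memY _ /andP[xy cyc'] /and3P[_ yc _].
have lY : last z c' \in z :: c' by apply: mem_last.
apply: (@deg_ge2 Y x y (last z c')).
- by apply: contraNneq yc => ->.
- by apply: memY; rewrite !inE eqxx orbT.
- by apply: memY; rewrite 2!in_cons lY !orbT.
- exact: xy.
- by move: cyc'; rewrite rcons_path => /and3P[_ _]; rewrite e_sym.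
Qed.
Hypothesis k2 : 2 <= k.

Local Notation E := (ecost k).

(** * Potentials and the induction measure *)

Definition charges w A : nat := \sum_(x in A) charge k (w x).
(* All potentials are at least [-2]. *)
Definition ok w S := forall A, A \subset S -> E * nedges A <= charges w A + 2.
Definition colorable w S := exists2 F : {set T}, F \subset S &
  {in S :\: F &, forall x y, ~~ e x y} /\ good w F.
Definition raise w w' A : nat := \sum_(x in A) (cost k (w' x) - cost k (w x)).
(** The induction measure. The successor makes it drop also when a vertex of weight at least [k] is
    removed. *)
Definition weight_gap w S : nat := \sum_(x in S) (k - w x).+1.

Lemma chargesU w A B : [disjoint A & B] -> charges w (A :|: B) = charges w A + charges w B.
Proof. exact: sum_setU. Qed.

Lemma charges_raise w w' A : {in A, forall x, w x <= w' x} ->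
  charges w A = charges w' A + raise w w' A.
Proof.
move=> h; rewrite -big_split /=; apply: eq_bigr => x /h /(cost_mono k2).
by have := chargeE k2 (w x); have := chargeE k2 (w' x); lia.
Qed.

(** A vertex forced into [I] has charge [(E-3)/2], just below the gap [(E-1)/2]; this is why [gap]
    excepts such singletons. *)
Lemma charges_big w A : {in A, forall x, k <= w x} -> 2 * charges w A + 3 * #|A| = E * #|A|.
Proof.
move=> h; rewrite /charges (eq_bigr (fun=> charge k k)); last first.
  move=> x /h /(cost_ge k2) kx.
  by have := chargeE k2 (w x); have := chargeE k2 k; rewrite kx cost_ge //; lia.
rewrite sum_nat_const; have := chargeE k2 k; rewrite cost_ge // => h1.
have -> : E = 2 * charge k k + 3 by lia.
by lia.
Qed.

Lemma raise_inc w z n A :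
  raise w (inc w z n) A = (z \in A) * (cost k (w z + n) - cost k (w z)).
Proof.
rewrite /raise /inc; case zA: (z \in A); last first.
  rewrite big1 // => x xA; case: eqP => [xz|]; first by rewrite -xz xA in zA.
  by rewrite muln0 addn0 subnn.
rewrite (bigD1 z) //= eqxx muln1 big1 ?addn0 ?mul1n // => x /andP[_ /negPf->].
by rewrite muln0 addn0 subnn.
Qed.

Lemma raise_le w w' A (f : T -> nat) :
  {in A, forall x, cost k (w' x) <= cost k (w x) + f x} ->
  raise w w' A <= \sum_(x in A) f x.
Proof. by move=> h; apply: leq_sum => x xA; have := h x xA; lia. Qed.

Lemma weight_gap_lt w w' S S' z : S' \subset S ->
  {in S', forall x, w x <= w' x} -> z \in S ->
  (z \in S' -> w z < k /\ w z < w' z) ->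
  weight_gap w' S' < weight_gap w S.
Proof.
move=> sS ww zS hz; rewrite /weight_gap.
rewrite [ltnRHS](big_setD1 z) //=.
have h : \sum_(x in S' :\ z) (k - w' x).+1 <= \sum_(x in S :\ z) (k - w x).+1.
  apply: leq_trans (leq_sum_sub _ (setSD [set z] sS)).
  by apply: leq_sum => x; rewrite !inE => /andP[_ /ww]; lia.
case zS': (z \in S').
  by rewrite (big_setD1 z) //=; have := hz zS'; lia.
have eS : S' :\ z = S' by apply/setDidPl; rewrite disjoint_sym disjoints1 zS'.
by rewrite -eS; lia.
Qed.

Lemma weight_gap_sub w w' S S' : S' \proper S ->
  {in S', forall x, w x <= w' x} -> weight_gap w' S' < weight_gap w S.
Proof.
move=> /properP[sS [z zS zS']] ww; apply: (weight_gap_lt sS ww zS).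
by rewrite (negPf zS').
Qed.

Lemma ok_sub w S S' : S' \subset S -> ok w S -> ok w S'.
Proof. by move=> s o A sA; apply: o; apply: subset_trans s. Qed.

Lemma cost_diff a n : cost k (a + n) - cost k a <= 3 * n.
Proof. by move: (cost_slope k2 a n); clia. Qed.

Definition coloring w S F :=
  [/\ F \subset S, {in S :\: F &, forall x y, ~~ e x y} & good w F].

(** The weights to use after deleting [v], so that [v] can still join the component of a neighbor in
    [F]. *)
Definition grow w v t : nat := w t + (w v).+1 * e v t.

Lemma coloring_le w w' S F : {in F, forall x, w x <= w' x} ->
  coloring w' S F -> coloring w S F.
Proof. by move=> h [sF iF gF]; split=> //; apply: good_le gF. Qed.

Lemma extend_I w S F v : v \notin S ->
  {in S, forall t, e v t -> t \in F} -> coloring w S F -> coloring w (v |: S) F.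
Proof.
move=> vS h [sF iF gF]; split=> //; first exact: subset_trans sF (subsetUr _ _).
have key t : t \in S :\: F -> ~~ e v t.
  by case/setDP => tS tF; apply: contra tF; apply: h.
move=> a b; rewrite !in_setD !in_setU1.
move=> /andP[aF /predU1P[->|aS]] /andP[bF /predU1P[->|bS]].
- by rewrite e_irr.
- by apply: key; rewrite in_setD bF.
- by rewrite e_sym; apply: key; rewrite in_setD aF.
- by apply: iF; rewrite in_setD ?aF ?bF.
Qed.

Lemma extend_F w S F v : v \notin S -> w v < k -> deg F v <= 1 ->
  coloring (grow w v) S F -> coloring w (v |: S) (v |: F).
Proof.
move=> vS wv dv [sF iF gF]; split; first exact: setUS.
  by move=> a b /setDP[/setU1P[->|aS]]; rewrite in_setU1 ?eqxx // negb_or => /andP[_ aF]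
    /setDP[/setU1P[->|bS]]; rewrite in_setU1 ?eqxx // negb_or => /andP[_ bF];
    apply: iF; apply/setDP.
by apply: good_add => //; apply: contra vS; apply: (subsetP sF).
Qed.

Lemma deg_full S F v : F \subset S -> deg S v <= deg F v ->
  {in S, forall t, e v t -> t \in F}.
Proof.
move=> sF d t tS vt; apply/negPn/negP => tF.
have : deg (t |: F) v <= deg S v by apply: deg_sub; rewrite subUset sub1set tS.
by rewrite degU ?disjoints1 // deg1 // vt; move: d; clia.
Qed.

(** With at most one neighbor in [F], [v] joins [F]; otherwise all its neighbors are in [F] and it
    joins [I]. *)
Lemma extend w S F v : v \notin S -> w v < k -> deg S v <= 2 ->
  coloring (grow w v) S F ->
  exists F', coloring w (v |: S) F'.
Proof.
move=> vS wv dv cF; have [d1|d1] := leqP (deg F v) 1.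
  by exists (v |: F); apply: extend_F.
exists F; apply: extend_I => //.
  by case: cF => sF _ _; apply: deg_full => //; move: dv d1; clia.
by apply: coloring_le cF => t _; apply: leq_addr.
Qed.

Lemma raise_supp2 w w' A x y :
  {in A, forall t, t != x -> t != y -> w' t = w t} ->
  raise w w' A <= (x \in A) * (cost k (w' x) - cost k (w x)) +
                  (y \in A) * (cost k (w' y) - cost k (w y)).
Proof.
move=> h; have one z : (z \in A) * (cost k (w' z) - cost k (w z)) =
    \sum_(t in A) (t == z) * (cost k (w' t) - cost k (w t)).
  case zA : (z \in A).
    rewrite mul1n (bigD1 z) //= eqxx mul1n big1 ?addn0 // => t /andP[_ /negPf->].
    by rewrite mul0n.
  by rewrite mul0n big1 // => t tA; case: eqP => // tz; rewrite -tz tA in zA.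
rewrite !one -big_split /=; apply: leq_sum => t tA.
have [->|tx] := eqVneq t x; first by clia.
have [->|ty] := eqVneq t y; first by clia.
by rewrite h // subnn.
Qed.

(** * Minimal counterexamples *)

Section Minimal.
Variables (w : T -> nat) (S : {set T}).
Hypothesis okS : ok w S.
Hypothesis IH : forall w' S', weight_gap w' S' < weight_gap w S ->
  ok w' S' -> colorable w' S'.
Hypothesis ncol : ~ colorable w S.

Lemma IHsub w' S' : S' \proper S -> {in S', forall x, w x <= w' x} ->
  ok w' S' -> colorable w' S'.
Proof. by move=> p ww; apply: IH; apply: weight_gap_sub. Qed.

(* [R] is a set of least potential [p - 2]; [lowp] says that it is minimal. *)
Section Gap.
Variables (R : {set T}) (p : nat).
Hypotheses (sR : R \subset S) (nR : R != S) (R0 : R != set0).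
Hypothesis Rbig : forall x, R = [set x] -> w x < k.
Hypothesis totR : charges w R + 2 = E * nedges R + p.
Hypothesis hp : 2 * p <= E.+1.
Hypothesis lowp : forall R', R' \subset S -> R' != S -> R' != set0 ->
  E * nedges R' + p <= charges w R' + 2.

Let W := S :\: R.

Let dRW : [disjoint R & W].
Proof. exact: disjoint_setD. Qed.

Let RW : R :|: W = S.
Proof. exact: setUD. Qed.

Let pR : R \proper S. Proof. by rewrite properEneq nR. Qed.

Let pW : W \proper S.
Proof.
rewrite properEneq subsetDl andbT; apply: contra R0 => /eqP h.
by rewrite -subset0; apply/subsetP => x xR; have := disjointFr dRW xR; rewrite h (subsetP sR).
Qed.

(** Compares the potentials of [A :|: R] and [R]. Minimality of [R] makes the former no smaller,
    unless the union is [S], where only the bound [-2] is known and [p] is lost. *)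
Let gain (A : {set T}) : A \subset W -> A != set0 ->
  E * (nedges A + cut A R) <= charges w A + (if A == W then p else 0).
Proof.
move=> sA A0; have dA : [disjoint A & R].
  by rewrite disjoint_sym; apply: disjointWr dRW.
have sAR : A :|: R \subset S by rewrite subUset sR andbT (subset_trans sA) ?subsetDl.
have := okS sAR; rewrite nedgesU // chargesU //.
case: eqP => [_|/eqP nA].
  by move: totR; rewrite !mulnDr; clia.
have /(lowp sAR) : A :|: R != S.
  apply: contra nA => /eqP eS; rewrite eqEsubset sA; apply/subsetP => x xW.
  have : x \in S by apply: (subsetP (subsetDl S R)).
  by rewrite -eS inE (disjointFl dRW xW) orbF.
rewrite nedgesU // chargesU // setU_eq0 negb_and A0 => /(_ isT).
by move: totR; rewrite !mulnDr; clia.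
Qed.

Let colorableU (FR FW : {set T}) : FR \subset R -> FW \subset W ->
  {in R :\: FR &, forall x y, ~~ e x y} ->
  {in W :\: FW &, forall x y, ~~ e x y} ->
  {in R :\: FR & W :\: FW, forall x y, ~~ e x y} ->
  good w (FR :|: FW) -> colorable w S.
Proof.
move=> sFR sFW iR iW iRW g; exists (FR :|: FW); first by rewrite -RW setUSS.
split=> // a b; rewrite -RW !inE !negb_or.
move=> /andP[/andP[a1 a2] aS] /andP[/andP[b1 b2] bS].
have [aR|aR] := boolP (a \in R); have [bR|bR] := boolP (b \in R);
  rewrite ?(negPf aR) ?(negPf bR) /= in aS bS.
- by apply: iR; rewrite inE ?a1 ?b1.
- by apply: iRW; rewrite !inE ?a1 ?b2 ?bR.
- by rewrite e_sym; apply: iRW; rewrite !inE ?a2 ?b1 ?aR.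
- by apply: iW; rewrite !inE ?a2 ?b2 ?aR ?bR.
Qed.

(* If the coloring of [R] puts a boundary vertex into [I], keep all such vertices
   [Z], with weight [k], as proxies for [R] while coloring the rest. *)
Section BoundaryI.
Variables (FR : {set T}).
Hypotheses (sFR : FR \subset R) (iR : {in R :\: FR &, forall x y, ~~ e x y}).
Hypothesis gR : good w FR.

Let Z := [set z in R :\: FR | 0 < deg W z].

Let sZ : Z \subset R :\: FR.
Proof. by apply/subsetP => x; rewrite inE => /andP[]. Qed.

Let sZR : Z \subset R. Proof. exact: subset_trans sZ (subsetDl _ _). Qed.

(** Besides [Z], the vertices of [W] adjacent to [FR] are forced into [I], so that no forest edge
    leaves [FR]. *)
Let w' t := if (t \in Z) || (0 < deg FR t) then maxn k (w t) else w t.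

Let ww' t : w t <= w' t. Proof. by rewrite /w'; case: ifP => // _; exact: leq_maxr. Qed.

Let dWZ : [disjoint W & Z].
Proof. by rewrite disjoint_sym; apply: disjointWl sZR dRW. Qed.

(** Edges to [FR] pay for the raised weights in [W], and edges to [Z] are among those to [R :\: FR].
    The loss [p] occurs only if [A] contains [W]. Then a vertex of [Z] in [A] compensates by its
    charge [(E-3)/2] and the slack 2; if there is none, an edge from [W] to [Z] is saved. *)
Let okWZ : Z != set0 -> ok w' (W :|: Z).
Proof.
move=> Z0 A sA; pose A1 := A :&: W; pose A2 := A :&: Z.
have eA : A = A1 :|: A2 by rewrite -setIUr; apply/esym/setIidPl.
have dA : [disjoint A1 & A2].
  by apply: disjointWl (subsetIr _ _) (disjointWr (subsetIr _ _) dWZ).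
have n2 : nedges A2 = 0.
  apply: nedges_indep => x y xA yA.
  by apply: iR; apply: (subsetP sZ); apply: (subsetP (subsetIr A Z)).
have t2 : 2 * charges w' A2 + 3 * #|A2| = E * #|A2|.
  by apply: charges_big => x /setIP[_ xZ]; rewrite /w' xZ leq_maxl.
have E5 := ecost_ge5 k2.
rewrite eA nedgesU // chargesU // n2 addn0.
have [A10|A10] := eqVneq A1 set0.
  by rewrite A10 /cut big_set0 nedges0 addn0 muln0.
have g := gain (subsetIr A W) A10.
have r1 : raise w w' A1 <= E * cut A1 FR.
  rewrite /cut big_distrr /=; apply: raise_le => x /setIP[_ xW].
  rewrite /w' (disjointFr dWZ xW) /=; case: posnP => [->|d0]; first by rewrite muln0 addn0.
  by move: d0 (cost_le k2 (maxn k (w x))); cnia.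
have c1 : cut A1 R = cut A1 FR + cut A1 (R :\: FR).
  by rewrite -cutUr ?disjoint_setD // setUD.
have c2 : cut A1 A2 <= cut A1 (R :\: FR).
  by apply: cut_sub => //; apply: subset_trans (subsetIr _ _) sZ.
have := charges_raise (A := A1) (fun x _ => ww' x).
move: g; rewrite -/A1 c1; case: eqP => [eW|_] g tr.
  2: { by move: r1 c2 g tr; cnia. }
have [A20|A20] := eqVneq A2 set0; last first.
  have a2 : 0 < #|A2| by rewrite card_gt0.
  have hE : E - 3 <= 2 * charges w' A2 by move: E5 t2 a2; cnia.
  by move: hE hp (ecost_odd k2) r1 c2 g tr; cnia.
have c3 : 0 < cut A1 (R :\: FR).
  have [z zZ] := set0Pn _ Z0; have := zZ; rewrite inE => /andP[zR /deg_gt0P[x xW zx]].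
  by apply/cut_gt0P; exists x, z; rewrite eW e_sym; split.
have -> : cut A1 A2 = 0 by rewrite A20 cutC // /cut big_set0.
by move: c3 hp r1 g tr E5; cnia.
Qed.

Lemma boundary_I : Z != set0 -> colorable w S.
Proof.
move=> Z0.
have sWZ : W :|: Z \subset S by rewrite -RW setUC setUSS.
have [F' sF' [iF gF]] : colorable w' (W :|: Z).
  apply: IH; last exact: okWZ.
  (* If nothing is removed, then [R] equals [Z], and some weight in [R] must have been below [k].
     Otherwise [R] is independent with potential [#|R| (E-3)/2], so [hp] makes it a singleton,
     contrary to [Rbig]. *)
  have [eS|nS] := eqVneq (W :|: Z) S; last first.
    by apply: weight_gap_sub => // ; rewrite properEneq nS.
  have RZ : R \subset Z.
    apply/subsetP => x xR; have : x \in W :|: Z by rewrite eS (subsetP sR).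
    by rewrite inE (disjointFr dRW xR).
  have [/exists_inP[z zR wz]|/exists_inPn wR] := boolP [exists z in R, w z < k].
    apply: (weight_gap_lt sWZ (fun x _ => ww' x) (subsetP sR z zR)) => _.
    by rewrite wz /w' (subsetP RZ) //= leq_max wz.
  have nR0 : nedges R = 0.
    by apply: nedges_indep => x y xR yR; apply: iR; apply: (subsetP sZ); apply: (subsetP RZ).
  have tR : 2 * charges w R + 3 * #|R| = E * #|R|.
    by apply: charges_big => x /wR; rewrite -leqNgt.
  have E5 := ecost_ge5 k2; have r0 : 0 < #|R| by rewrite card_gt0.
  have : #|R| == 1 by move: totR hp tR E5 r0; rewrite nR0 muln0 add0n; cnia.
  case/cards1P => x eR; have xR : x \in R by rewrite eR set11.
  by have := wR x xR; rewrite (Rbig eR).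
have F'0 x : x \in F' -> x \in W /\ deg FR x = 0.
  move=> xF; have := good_lt gF xF; rewrite /w'.
  have := subsetP sF' x xF; rewrite inE; case: (x \in Z) => /=; first by rewrite gtn_max ltnn.
  by rewrite orbF => ->; case: posnP => //; rewrite gtn_max ltnn.
have sF'W : F' \subset W by apply/subsetP => x /F'0[].
have dFF : [disjoint FR & F'] by apply: disjointWl sFR (disjointWr sF'W dRW).
apply: (colorableU sFR sF'W iR).
- by move=> x y /setDP[x1 x2] /setDP[y1 y2]; apply: iF;
    apply/setDP; split=> //; apply/setUP; left.
- move=> x y xR yW; apply/negP => xy.
  have xZ : x \in Z.
    rewrite inE xR; apply/deg_gt0P; exists y => //.
    by case/setDP: yW.
  have xF : x \notin F'.
    by apply/negP => /(subsetP sF'W) xW; have := disjointFl dWZ xZ; rewrite xW.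
  case/setDP: yW => y1 y2; suff : ~~ e x y by rewrite xy.
  by apply: iF; apply/setDP; split=> //; apply/setUP; [right | left].
- apply: good_disjoint => //; last by apply: good_le gF.
  by rewrite cutC // /cut big1 // => x /F'0[].
Qed.
End BoundaryI.

(* Otherwise only the component of [z], which has room for [i] more, is joined
   to the rest, along the edge from [z] to [x]. *)
Section BoundaryF.
Variables (FR : {set T}) (z x : T) (i : nat).
Hypotheses (sFR : FR \subset R) (iR : {in R :\: FR &, forall x y, ~~ e x y}).
Hypothesis ik : i <= k.
Hypothesis cost_ki : forall a, cost k (a + (k - i)) + p <= cost k a + E.+2.
Hypothesis gR : good (inc w z i) FR.
Hypotheses (zR : z \in R) (xW : x \in W) (zx : e z x).
Hypothesis noI : {in R :\: FR & W, forall y t, ~~ e y t}.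

(** Neighbors of [R] are forced into [I], except [x] when [z] is its only neighbor in [R]; its
    component may then have size at most [i]. *)
Let w' t := if deg R t == 0 then w t else
  if (t == x) && (deg R t == 1) then w t + (k - i) else maxn k (w t).

Let ww' t : w t <= w' t.
Proof.
rewrite /w'; case: ifP => // _; case: ifP => _; first exact: leq_addr.
exact: leq_maxr.
Qed.

Let raise1 t : cost k (w' t) <= cost k (w t) + E * deg R t.
Proof.
have [d0|d0] := posnP (deg R t); first by rewrite /w' d0 /= muln0 addn0.
by move: (cost_le k2 (w' t)) d0; cnia.
Qed.

Let dx : 0 < deg R x.
Proof. by apply/deg_gt0P; exists z; rewrite // e_sym. Qed.

(** Recovers the loss [p] of [gain]: by the choice of [i] if [x] has one neighbor in [R], and
    otherwise because two edges pay for a raise of cost at most [E]. *)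
Let raisex : cost k (w' x) + p <= cost k (w x) + (E * deg R x).+2.
Proof.
have [d1|d1] := eqVneq (deg R x) 1.
  by rewrite /w' d1 eqxx /= muln1; apply: cost_ki.
by move: dx d1 (cost_le k2 (w' x)) hp (ecost_ge5 k2); cnia.
Qed.

Let okW : ok w' W.
Proof.
move=> A sA; have [->|A0] := eqVneq A set0; first by rewrite nedges0 muln0.
have g := gain sA A0.
have tr := charges_raise (A := A) (fun x _ => ww' x).
case: (eqVneq A W) g => [eW|_] g; last first.
  have r : raise w w' A <= E * cut A R.
    by rewrite /cut big_distrr /=; apply: raise_le => t _.
  by move: g tr r; rewrite addn0 mulnDr; clia.
have xA : x \in A by rewrite eW.
suff r : raise w w' A + p <= E * cut A R + 2.
  by move: g tr r; rewrite mulnDr; clia.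
rewrite /raise /cut (bigD1 x) //= [X in _ * X](bigD1 x) //= mulnDr.
have : \sum_(t in A | t != x) (cost k (w' t) - cost k (w t)) <=
       E * \sum_(t in A | t != x) deg R t.
  rewrite big_distrr /=; apply: leq_sum => t _.
  by move: (raise1 t); clia.
by move: raisex (cost_mono k2 (ww' x)); clia.
Qed.

Lemma boundary_F : colorable w S.
Proof.
have [F' sF' [iF gF]] := IHsub pW (fun x _ => ww' x) okW.
have dFF : [disjoint FR & F'] by apply: disjointWl sFR (disjointWr sF' dRW).
have zF : z \in FR.
  apply/negPn/negP => zF; suff : ~~ e z x by rewrite zx.
  by apply: noI => //; apply/setDP.
have F'R t : t \in F' -> 0 < deg R t -> t = x /\ deg R t = 1.
  move=> tF dt; have := good_lt gF tF; rewrite /w' -[_ == 0]negbK -lt0n dt /=.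
  by case: andP => [[/eqP-> /eqP->]|_] //; rewrite gtn_max ltnn.
apply: (colorableU sFR sF' iR iF).
  by move=> y t yR /setDP[tW _]; apply: noI.
have gR' : good w FR by apply: good_le gR => t _; apply: leq_addr.
have gF' : good w F' by apply: good_le gF.
have sFRd t : deg FR t <= deg R t by apply: deg_sub.
have [xF|xF] := boolP (x \in F'); last first.
  apply: good_disjoint => //.
  rewrite cutC // /cut big1 // => t tF; apply/eqP; rewrite -leqn0.
  apply: leq_trans (sFRd t) _; rewrite leqNgt; apply/negP => dt.
  by have [tx _] := F'R t tF dt; rewrite -tx tF in xF.
have [_ d1] := F'R x xF dx.
apply: (good_merge ik dFF zF xF _ gR); last first.
  apply: good_le gF => t tF; rewrite /inc.
  have [->|_] := eqVneq t x; first by rewrite /w' d1 eqxx muln1.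
  by rewrite muln0 addn0; exact: ww'.
move=> a b aF bF ab.
have db : 0 < deg R b by apply/deg_gt0P; exists a; rewrite ?(subsetP sFR) // e_sym.
have [bx _] := F'R b bF db; split=> //.
apply: (@deg_le1 R x); rewrite ?d1 ?(subsetP sFR) // e_sym // -bx //.
Qed.
End BoundaryF.

Lemma gap_step : False.
Proof.
apply: ncol.
have [c0|cpos] := posnP (cut R W).
  have [FR sFR [iR gR]] := IHsub pR (fun x _ => leqnn (w x)) (ok_sub sR okS).
  have [FW sFW [iW gW]] :=
    IHsub pW (fun x _ => leqnn (w x)) (ok_sub (subsetDl S R) okS).
  apply: (colorableU sFR sFW iR iW).
    move=> a b /setDP[aR _] /setDP[bW _].
    apply/negP => ab; have : 0 < cut R W; last by rewrite c0.
    by apply/cut_gt0P; exists a, b.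
  apply: good_disjoint => //; first exact: disjointWl sFR (disjointWr sFW dRW).
  by apply/eqP; rewrite -leqn0 -c0; apply: cut_sub.
have /cut_gt0P[z [x [zR xW zx]]] := cpos.
have [i [ik ci cki]] := split_cost k2 hp.
have wi t : w t <= inc w z i t by apply: leq_addr.
(* Nonempty subsets of [R] have potential at least [p - 2], and the raise at [z] costs at most
   [p]. *)
have okR : ok (inc w z i) R.
  move=> A sA; have tr := charges_raise (A := A) (fun t _ => wi t).
  have [->|A0] := eqVneq A set0; first by rewrite nedges0 muln0.
  have sAS : A \subset S by apply: subset_trans sR.
  have nAS : A != S.
    by apply: contra nR => /eqP eA; rewrite eqEsubset sR -eA.
  move: tr (lowp sAS nAS A0); rewrite raise_inc.
  case: (z \in A); first by move: (ci (w z)); clia.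
  by clia.
have [FR sFR [iR gR]] := IHsub pR (fun t _ => wi t) okR.
have gR' : good w FR by apply: good_le gR.
have [Z0|] := boolP [exists y in R :\: FR, 0 < deg W y].
  have [y yR dy] := exists_inP Z0.
  by apply: (boundary_I sFR iR gR'); apply/set0Pn; exists y; rewrite inE yR.
move=> /exists_inPn noZ; apply: (boundary_F sFR iR ik cki gR zR xW zx).
move=> y t yR tW; apply/negP => yt; have := noZ y yR; apply/negP/negPn.
by apply/deg_gt0P; exists t.
Qed.
End Gap.

(** A violator of least potential meets the hypotheses of [gap_step]. By parity its potential is at
    most [(E-3)/2], hence at most that of the excepted singletons. *)
Lemma gap R : R \subset S -> R != S -> R != set0 ->
  (forall x, R = [set x] -> w x < k) ->
  2 * (E * nedges R) + E <= 2 * charges w R + 1.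
Proof.
move=> sR nR R0 Rb; rewrite leqNgt; apply/negP => bad.
pose P A := [&& A \subset S, A != S, A != set0,
  [forall x, (A == [set x]) ==> (w x < k)] &
  2 * charges w A + 1 < 2 * (E * nedges A) + E].
have PR : P R.
  by rewrite /P sR nR R0 bad andbT; apply/forallP => x; apply/implyP => /eqP/Rb.
have [A /and5P[sA nA A0 bA badA] minA] :=
  @arg_minnP _ R P (fun A => charges w A + 2 - E * nedges A) PR.
have oA := okS sA; have oE := ecost_odd k2.
have hp : 2 * (charges w A + 2 - E * nedges A) <= E.+1.
  by move: badA oE oA; clia.
apply: (gap_step sA nA A0 _ _ hp).
- by move=> x eA; have /forallP/(_ x) := bA; rewrite eA eqxx.
- by rewrite subnKC.
move=> B sB nB B0; have oB := okS sB; have [PB|] := boolP (P B).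
  by move: (minA B PB) oB; clia.
rewrite /P sB nB B0 /= negb_and -leqNgt => /orP[/forallPn[x]|].
  rewrite negb_imply -leqNgt => /andP[/eqP eB wx].
  have : 2 * charges w B + 3 * #|B| = E * #|B|.
    by apply: charges_big => y; rewrite eB inE => /eqP->.
  by rewrite eB nedges1 // cards1; move: hp; clia.
by move: hp oB; clia.
Qed.

(** * Reducible configurations *)

Lemma not_coloring F : ~ coloring w S F.
Proof. by case=> sF iF gF; apply: ncol; exists F. Qed.

(** The gap [(E-1)/2] and the slack 2 together pay for raises of total cost [(E+3)/2]; an excepted
    singleton has no edges. *)
Lemma raise_ok w' A : A \subset S -> A != S -> {in A, forall x, w x <= w' x} ->
  2 * raise w w' A <= E + 3 -> E * nedges A <= charges w' A + 2.
Proof.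
move=> sA nA ww hr; have [->|A0] := eqVneq A set0; first by rewrite nedges0 muln0.
have tr := charges_raise ww.
have [/existsP[x /andP[/eqP eA wx]]|/existsPn nx] :=
  boolP [exists x, (A == [set x]) && (k <= w x)].
  by rewrite eA nedges1 // muln0.
have : 2 * (E * nedges A) + E <= 2 * charges w A + 1.
  apply: gap => // x eA; have := nx x; rewrite eA eqxx /= -ltnNge //.
by move: hr tr; clia.
Qed.

Lemma delete X w' : X \subset S -> X != set0 ->
  {in S :\: X, forall x, w x <= w' x} -> ok w' (S :\: X) ->
  exists F, coloring w' (S :\: X) F.
Proof.
move=> sX X0 ww o.
have pX : S :\: X \proper S.
  rewrite properE subsetDl; apply: contra X0 => /subsetP h.
  rewrite -subset0; apply/subsetP => x xX.
  by have := h x (subsetP sX x xX); rewrite inE xX.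
by have [F sF [iF gF]] := IHsub pX ww o; exists F.
Qed.

Lemma delete_ok X w' : X \subset S -> X != set0 ->
  {in S :\: X, forall x, w x <= w' x} ->
  (forall A, A \subset S :\: X -> 2 * raise w w' A <= E + 3) ->
  exists F, coloring w' (S :\: X) F.
Proof.
move=> sX X0 ww hr; apply: delete => // A sA.
have sAS : A \subset S by apply: subset_trans sA (subsetDl _ _).
apply: raise_ok => //; last exact: hr.
  apply: contra X0 => /eqP eA; rewrite -subset0; apply/subsetP => x xX.
  by have := subsetP sA x; rewrite eA (subsetP sX) // inE xX => /(_ isT).
by move=> x xA; apply: ww; apply: (subsetP sA).
Qed.

(** After coloring [S :\ x], the vertex [x] goes to [I] if all its neighbors are in [F], and
    otherwise to [F] as an isolated vertex unless its weight forbids it. *)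
Lemma deg_big x : x \in S -> deg S x <= 1 -> k <= w x /\ deg S x = 1.
Proof.
move=> xS d1; have sx : [set x] \subset S by rewrite sub1set.
have x0 : [set x] != set0 by apply/set0Pn; exists x; rewrite inE.
have [F cF] : exists F, coloring w (S :\ x) F.
  by apply: delete => //; apply: ok_sub okS; apply: subsetDl.
have xSx : x \notin S :\ x by rewrite !inE eqxx.
have dx : deg S x = deg (S :\ x) x by rewrite (degD1 _ xS) e_irr addn0.
have [sF _ _] := cF.
have [dF|dF] := leqP (deg (S :\ x) x) (deg F x).
  case: (@not_coloring F); rewrite -(setD1K xS); apply: extend_I => //.
  exact: deg_full.
have [wx|wx] := leqP k (w x); first by split=> //; move: d1 dF; rewrite dx; clia.
have dF0 : deg F x = 0 by move: d1 dF; rewrite dx; clia.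
case: (@not_coloring (x |: F)); rewrite -(setD1K xS).
apply: extend_F; rewrite // ?dF0 //.
by apply: coloring_le cF => t tF; rewrite /grow (deg0 dF0 tF) muln0 addn0.
Qed.

Lemma grow_false v F : v \in S -> w v < k -> deg S v <= 2 ->
  coloring (grow w v) (S :\ v) F -> False.
Proof.
move=> vS wv dv cF; have := @extend w (S :\ v) F v.
rewrite !inE eqxx => /(_ isT wv _ cF)[|F'].
  by apply: leq_trans dv; apply: deg_sub; apply: subsetDl.
by rewrite setD1K // => /not_coloring.
Qed.

(** Raising a neighbor already forced into [I] is free, so deleting [v] loads only its other
    neighbor, which the gap can pay for. *)
Lemma delete_big v z : v \in S -> deg S v = 2 -> w v < k ->
  6 * (w v).+1 <= E + 3 -> z \in S -> e v z -> w z < k.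
Proof.
move=> vS dv wv hv zS vz; rewrite ltnNge; apply/negP => wz.
have [x [y [[xy xS yS vx vy] nxy]]] := deg2P dv.
wlog zx : x y xy xS yS vx vy nxy / z = x.
  move=> wl; have [zx|zx] := eqVneq z x; first exact: (wl x y).
  have [zy|zy] := eqVneq z y; last by have := nxy z zS zx zy; rewrite vz.
  apply: (wl y x) => //; first by rewrite eq_sym.
  by move=> t tS ty tx; apply: nxy.
have [F] : exists F, coloring (grow w v) (S :\: [set v]) F.
  apply: delete_ok => [||t _|A sA]; rewrite ?sub1set //.
  - by apply/set0Pn; exists v; rewrite inE.
  - exact: leq_addr.
  have : raise w (grow w v) A <= (x \in A) * (cost k (grow w v x) - cost k (w x)) +
                  (y \in A) * (cost k (grow w v y) - cost k (w y)).
    apply: raise_supp2 => t tA tx ty.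
    have tS : t \in S by have := subsetP sA t tA; rewrite inE => /andP[].
    by rewrite /grow (nxy t tS tx ty) muln0 addn0.
  rewrite /grow vx vy muln1 -zx (cost_ge k2 wz) (cost_ge (a := w z + _) k2); last first.
    by apply: leq_trans wz (leq_addr _ _).
  by move: (cost_diff (w y) (w v).+1) hv; rewrite subnn muln0; case: (y \in A); clia.
by apply: grow_false => //; rewrite dv.
Qed.

(** The gap covers sets missing [x] or [y]. A set [A] with both is compared with [v |: A]; if that
    is all of [S], only the slack [d] in the potential of [S] helps. *)
Lemma delete_deg2 v x y d : v \in S -> deg S v = 2 -> w v < k ->
  6 * (w v).+1 <= E + 3 ->
  x != y -> x \in S -> y \in S -> e v x -> e v y ->
  d <= 1 -> E * nedges S + d <= charges w S + 2 ->
  2 * ((cost k (w x + (w v).+1) - cost k (w x)) +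
       (cost k (w y + (w v).+1) - cost k (w y))) <= E + 3 + 2 * cost k (w v) + 2 * d ->
  False.
Proof.
move=> vS dv wv hv xy xS yS vx vy d1 hd hc.
have nxy t : t \in S -> t != x -> t != y -> e v t = false.
  move=> tS tx ty; apply/negP => vt.
  have : 3 <= deg S v; last by rewrite dv.
  rewrite (degD1 v tS) vt addn1 ltnS (deg_ge2 xy) ?inE //.
    by rewrite eq_sym tx.
  by rewrite eq_sym ty.
have [F] : exists F, coloring (grow w v) (S :\: [set v]) F.
  apply: delete => [||t _|A sA]; rewrite ?sub1set //.
  - by apply/set0Pn; exists v; rewrite inE.
  - exact: leq_addr.
  have sAS : A \subset S by apply: subset_trans sA (subsetDl _ _).
  have vA : v \notin A by apply/negP => /(subsetP sA); rewrite !inE eqxx.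
  have nA : A != S by apply: contraNneq vA => ->.
  have ww t : w t <= grow w v t by apply: leq_addr.
  have : raise w (grow w v) A <= (x \in A) * (cost k (grow w v x) - cost k (w x)) +
                  (y \in A) * (cost k (grow w v y) - cost k (w y)).
    apply: raise_supp2 => t tA tx ty.
    by rewrite /grow (nxy t (subsetP sAS _ tA) tx ty) muln0 addn0.
  rewrite {2 3}/grow vx vy muln1 => hr.
  have [/andP[xA yA]|nb] := boolP ((x \in A) && (y \in A)); last first.
    apply: raise_ok => //; move: hr nb hv.
    move: (cost_diff (w x) (w v).+1) (cost_diff (w y) (w v).+1).
    by case: (x \in A); case: (y \in A) => //=; clia.
  have dA : deg A v = 2.
    by apply/eqP; rewrite eqn_leq (deg_ge2 xy) // -dv deg_sub.
  have sB : v |: A \subset S by rewrite subUset sub1set vS.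
  have dis : [disjoint [set v] & A] by rewrite disjoints1.
  have eB : nedges (v |: A) = nedges A + deg A v.
    by rewrite nedgesU // nedges1 // cut1l.
  have cB : charges w (v |: A) = charge k (w v) + charges w A.
    by rewrite chargesU // /charges big_set1.
  have tr := charges_raise (A := A) (fun t _ => ww t).
  have ch := chargeE k2 (w v).
  have : 2 * (E * nedges (v |: A)) + 2 * d <= 2 * charges w (v |: A) + 4.
    have [->|nB] := eqVneq (v |: A) S; first by move: hd; clia.
    have : 2 * (E * nedges (v |: A)) + E <= 2 * charges w (v |: A) + 1.
      apply: gap => //; first by apply/set0Pn; exists v; rewrite !inE eqxx.
      move=> t eBt; have : v \in v |: A by rewrite !inE eqxx.
      by rewrite eBt inE => /eqP<-.
    by move: (ecost_ge5 k2) d1; clia.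
  by rewrite eB cB dA mulnDr; move: hr hc tr ch; rewrite xA yA !mul1n; clia.
by apply: grow_false => //; rewrite dv.
Qed.

(** Only the outer neighbor of [u] is loaded. If the outer neighbor of [v] is in [F], then [u] goes
    to [F] and [v] to [I]; failing that, if the one of [u] is in [F], the roles are exchanged. If
    neither is, [u] and [v] form a component. *)
Lemma delete_pair u v : u \in S -> v \in S -> e u v ->
  deg S u = 2 -> deg S v = 2 -> w u + w v + 2 <= k -> 6 * (w u).+1 <= E + 3 -> False.
Proof.
move=> uS vS uv du dv wuv hu.
have nuv : u != v by apply: contraTneq uv => ->; rewrite e_irr.
have [x0 [y0 [[xy xS yS ux uy] nxy]]] := deg2P du.
have [x [xS' nx]] : exists x, x \in S /\
    {in S, forall t, t != x -> t != v -> e u t = false}.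
  have [vx|vx] := eqVneq v x0.
    by exists y0; split=> // t tS ty tv; apply: nxy; rewrite // -vx.
  have [vy|vy] := eqVneq v y0.
    by exists x0; split=> // t tS ty tv; apply: nxy; rewrite // -vy.
  by have := nxy v vS vx vy; rewrite uv.
pose S0 := S :\: [set u; v].
have sX : [set u; v] \subset S by apply/subsetP => t /set2P[->|->].
have uS0 : u \notin S0 by rewrite !inE eqxx.
have vS0 : v \notin S0 by rewrite !inE eqxx orbT.
have eS : S = v |: (u |: S0).
  by rewrite setUA (setUC [set v]) setUD.
have uvS0 : v \notin u |: S0 by rewrite in_setU1 negb_or eq_sym nuv.
have vuS0 : u \notin v |: S0 by rewrite in_setU1 negb_or nuv.
have dS t : deg S t = e t v + (e t u + deg S0 t).
  by rewrite eS degU ?disjoints1 // degU ?disjoints1 // !deg1.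
have dv0 : deg S0 v = 1 by move: (dS v); rewrite dv e_irr e_sym uv; clia.
have du0 : deg S0 u = 1 by move: (dS u); rewrite du e_irr uv; clia.
have [F cF] : exists F, coloring (grow w u) S0 F.
  apply: delete_ok => [||t _|A sA] //.
  - by apply/set0Pn; exists u; rewrite !inE eqxx.
  - exact: leq_addr.
  have vA : v \notin A by apply: contra vS0; apply: (subsetP sA).
  have : raise w (grow w u) A <= (x \in A) * (cost k (grow w u x) - cost k (w x)) +
                  (v \in A) * (cost k (grow w u v) - cost k (w v)).
    apply: raise_supp2 => t tA tx tv.
    have tS : t \in S by have := subsetP sA t tA; rewrite inE => /andP[].
    by rewrite /grow (nx t tS tx tv) muln0 addn0.
  have : cost k (grow w u x) - cost k (w x) <= 3 * (w u).+1.
    rewrite /grow; case: (e u x); rewrite ?muln1 ?muln0 ?addn0 ?subnn //.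
    exact: cost_diff.
  by rewrite (negPf vA); move: hu; case: (x \in A); clia.
have [sF _ _] := cF.
have uF : u \notin F by apply: contra uS0; apply: (subsetP sF).
have vF : v \notin F by apply: contra vS0; apply: (subsetP sF).
have wu : w u < k by move: wuv; clia.
have wv : w v < k by move: wuv; clia.
have dFu : deg F u <= 1 by rewrite -du0; apply: deg_sub.
have dFv : deg F v <= 1 by rewrite -dv0; apply: deg_sub.
have c1 : coloring w (u |: S0) (u |: F) by apply: extend_F.
have [d0|dpos] := posnP (deg F v); last first.
  apply: (@not_coloring (u |: F)); rewrite eS; apply: extend_I => // t.
  move=> /setU1P[->|tS0] vt; first by rewrite !inE eqxx.
  by rewrite in_setU1 (deg_full sF _ tS0 vt) ?orbT // dv0.
have cw : coloring w S0 F by apply: coloring_le cF => t _; apply: leq_addr.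
have cv : coloring (grow w v) S0 F.
  by apply: coloring_le cw => t tF; rewrite /grow (deg0 d0 tF) muln0 addn0.
have [d0u|dpos] := posnP (deg F u); last first.
  apply: (@not_coloring (v |: F)); rewrite eS setUCA.
  apply: extend_I => //; last by apply: extend_F => //.
  move=> t /setU1P[->|tS0] ut; first by rewrite !inE eqxx.
  by rewrite in_setU1 (deg_full sF _ tS0 ut) ?orbT // du0.
apply: (@not_coloring (v |: (u |: F))); rewrite eS; apply: extend_F => //.
  by rewrite degU ?disjoints1 // deg1 d0 addn0; case: (e v u).
apply: extend_F => //.
- by rewrite /grow e_sym uv muln1; move: wuv; clia.
- by apply: coloring_le cw => t tF; rewrite /grow (deg0 d0 tF) (deg0 d0u tF) !muln0 !addn0.
Qed.

(* [x] goes to [I] if its third neighbor is in [F]; then [v] and [v'] fit into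
   the components next to them.  Otherwise [x] goes to [F], and [v], [v'] join
   it unless they can go to [I]. *)
Lemma delete_star x v v' j : x \in S -> v \in S -> v' \in S ->
  e x v -> e x v' -> v != v' -> ~~ e v v' ->
  w x = 0 -> w v = j -> w v' = j -> deg S x = 3 -> deg S v = 2 -> deg S v' = 2 ->
  2 * j + 3 <= k -> 6 * j.+1 <= E + 3 -> cost k j = 3 * j -> False.
Proof.
move=> xS vS vS' xv xv' nvv evv wx wv wv' dx dv dv' jk jE cj.
have nxv : x != v by apply: contraTneq xv => ->; rewrite e_irr.
have nxv' : x != v' by apply: contraTneq xv' => ->; rewrite e_irr.
pose X := x |: [set v; v']; pose S0 := S :\: X.
have sX : X \subset S by apply/subsetP => t; rewrite !inE => /or3P[] /eqP->.
have dX : [disjoint X & S0] by apply: disjoint_setD.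
have eS : S = X :|: S0 by rewrite setUD.
have dx0 : [disjoint [set x] & [set v; v']].
  by rewrite disjoints1 !inE negb_or nxv.
have dv0 : [disjoint [set v] & [set v']] by rewrite disjoints1 inE.
have dXE t : deg X t = e t x + (e t v + e t v').
  by rewrite degU // degU // !deg1.
have dS t : deg S t = e t x + (e t v + e t v') + deg S0 t.
  by rewrite {1}eS degU // dXE.
have evv' : e v v' = false by apply/negbTE.
have dSx : deg S0 x = 1 by move: (dS x); rewrite dx xv xv' e_irr; clia.
have dSv : deg S0 v = 1.
  by move: (dS v); rewrite dv e_irr evv' e_sym xv; clia.
have dSv' : deg S0 v' = 1.
  by move: (dS v'); rewrite dv' e_irr !(e_sym v') evv' xv'; clia.
have nX : nedges X = 2.
  rewrite nedgesU // cut1l degU // !deg1 xv xv' nedges1 // nedgesU // !nedges1 //.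
  by rewrite cut1l deg1 evv'.
pose w' t := w t + j.+1 * (e v t + e v' t).
have ww t : w t <= w' t by apply: leq_addr.
have [F cF] : exists F, coloring w' S0 F.
  have X0 : X != set0 by apply/set0Pn; exists x; rewrite !inE eqxx.
  apply: delete => // A sA.
  have sAS : A \subset S by apply: subset_trans sA (subsetDl _ _).
  have hr : raise w w' A <= 3 * j.+1 * (deg A v + deg A v').
    rewrite /deg -big_split big_distrr /=; apply: raise_le => t _.
    by rewrite /w' -mulnA; exact: cost_slope.
  have dA1 : deg A v <= 1 by rewrite -dSv; apply: deg_sub.
  have dA1' : deg A v' <= 1 by rewrite -dSv'; apply: deg_sub.
  have [d1|d2] := leqP (deg A v + deg A v') 1.
    apply: raise_ok => //.
      apply/eqP => eA; have := subsetP sA x; rewrite eA xS => /(_ isT).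
      by rewrite !inE eqxx.
    by move: hr d1 jE; cnia.
  have s2 : deg A v + deg A v' = 2 by move: d2 dA1 dA1'; clia.
  rewrite s2 in hr.
  have tr := charges_raise (A := A) (fun t _ => ww t).
  have dXA : [disjoint X & A] by apply: disjointWr dX.
  have eN : nedges (X :|: A) = 4 + nedges A + deg A x.
    rewrite nedgesU // nX /cut sum_setU // big_set1 sum_setU // !big_set1.
    by move: d2 dA1 dA1'; clia.
  have eC : charges w (X :|: A) = charge k 0 + 2 * charge k j + charges w A.
    rewrite chargesU // /charges sum_setU // big_set1 sum_setU // !big_set1.
    by rewrite wx wv wv'; clia.
  have sXA : X :|: A \subset S by rewrite subUset sX.
  have c0 := chargeE k2 0; have cj' := chargeE k2 j; rewrite cost0 in c0.
  have E5 := ecost_ge5 k2.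
  (* If the third neighbor of [x] is in [A], the fifth edge makes the bound [-2] for [X :|: A]
     sufficient; if not, that set is proper and has the gap. *)
  have [dA0|dApos] := posnP (deg A x); last first.
    have dA : deg A x = 1.
      by apply/eqP; rewrite eqn_leq dApos -dSx deg_sub.
    have := okS sXA; rewrite eN eC dA !mulnDr.
    by move: tr hr c0 cj' E5 cj; clia.
  have : 2 * (E * nedges (X :|: A)) + E <= 2 * charges w (X :|: A) + 1.
    apply: gap => //.
    - apply/eqP => eXA; suff : deg S0 x <= deg A x by rewrite dSx dA0.
      apply: deg_sub; apply/subsetP => t tS0.
      have : t \in X :|: A by rewrite eXA eS inE tS0 orbT.
      by rewrite inE (disjointFl dX tS0).
    - by apply/set0Pn; exists x; rewrite !inE eqxx.
    - move=> t eXt; have : x \in X :|: A by rewrite !inE eqxx.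
      by rewrite eXt inE => /eqP<-; rewrite wx; move: jk; clia.
  by rewrite eN eC dA0 !mulnDr; move: tr hr c0 cj' E5 cj; clia.
have [sF _ _] := cF.
have notin t : t \in X -> (t \notin S0) * (t \notin F).
  by move=> tX; rewrite (disjointFr dX tX); split=> //;
     apply/negP => /(subsetP sF); rewrite (disjointFr dX tX).
have xX : x \in X by rewrite !inE eqxx.
have vX : v \in X by rewrite !inE eqxx orbT.
have vX' : v' \in X by rewrite !inE eqxx !orbT.
have [d0|dpos] := posnP (deg F x); last first.
  pose w1 := grow w v'.
  have c1 : coloring w1 (v |: S0) (v |: F).
    apply: extend_F; rewrite ?notin //.
    - by rewrite /w1 /grow e_sym evv' muln0 addn0 wv; move: jk; clia.
    - by rewrite -dSv; apply: deg_sub.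
    - apply: coloring_le cF => t _.
      by rewrite /w1 /grow /w' e_sym (e_sym v' v) evv' muln0 addn0 wv wv'; rewrite (e_sym t); clia.
  have c2 : coloring w (v' |: (v |: S0)) (v' |: (v |: F)).
    apply: extend_F; rewrite // ?in_setU1 ?negb_or ?notin ?andbT //.
    - by rewrite eq_sym.
    - by rewrite wv'; move: jk; clia.
    - rewrite degU ?disjoints1 ?notin // deg1 e_sym evv' add0n -dSv'.
      exact: deg_sub.
  apply: (@not_coloring (v' |: (v |: F))).
  have -> : S = x |: (v' |: (v |: S0)) by rewrite {1}eS /X -!setUA (setUCA [set v]).
  apply: extend_I => //.
    by rewrite !in_setU1 !negb_or nxv nxv' notin.
  move=> t /setU1P[->|/setU1P[->|tS0]] xt; rewrite !inE ?eqxx ?orbT //.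
  by rewrite (deg_full sF _ tS0 xt) ?orbT // dSx.
have c1 : coloring w' (x |: S0) (x |: F).
  apply: extend_F; rewrite ?notin ?d0 //.
    by rewrite /w' wx !(e_sym _ x) xv xv'; move: jk; clia.
  by apply: coloring_le cF => t tF; rewrite /grow (deg0 d0 tF) muln0 addn0.
have [F1 c2] : exists F1, coloring (grow w v') (v |: (x |: S0)) F1.
  apply: (@extend _ _ (x |: F)).
  - by rewrite in_setU1 negb_or eq_sym nxv notin.
  - by rewrite /grow e_sym evv' muln0 addn0 wv; move: jk; clia.
  - by rewrite degU ?disjoints1 ?notin // deg1 dSv; case: (e v x).
  - apply: coloring_le c1 => t _.
    by rewrite /grow /w' (e_sym v' v) evv' muln0 addn0 wv wv'; clia.
have [F2 c3] : exists F2, coloring w (v' |: (v |: (x |: S0))) F2.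
  apply: (extend _ _ _ c2).
  - by rewrite !in_setU1 !negb_or eq_sym nvv eq_sym nxv' notin.
  - by rewrite wv'; move: jk; clia.
  - rewrite degU ?disjoints1 ?in_setU1 ?negb_or ?notin ?andbT //; last by rewrite eq_sym.
    rewrite degU ?disjoints1 ?notin // !deg1 dSv' e_sym evv'.
    by case: (e v' x).
apply: (@not_coloring F2).
have -> // : S = v' |: (v |: (x |: S0)).
by rewrite {1}eS /X -!setUA setUCA (setUCA [set x]) setUCA.
Qed.

(** * Discharging *)

Section Endgame.
Variables (h o : nat).
Hypotheses (ek : k = h.*2 + o) (o1 : o <= 1) (h0 : 0 < h).

Let eE : E + 1 + o = 3 * k. Proof. exact: (ecostP k2 ek o1 h0). Qed.
Let costI j := costP j ek o1 h0.

(* The only vertices with positive initial charge. *)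
Definition light := [set v in S | (deg S v == 2) && (w v == h.-1)].
Definition heavy := S :\: light.

Let sB : light \subset S.
Proof. by apply/subsetP => v; rewrite inE => /andP[]. Qed.

Let sA : heavy \subset S. Proof. exact: subsetDl. Qed.

Let dAB : [disjoint heavy & light].
Proof. by rewrite disjoint_sym; apply: disjoint_setD. Qed.

Let eS : S = heavy :|: light.
Proof. by rewrite setUC setUD. Qed.

Let lightP v : v \in light -> [/\ v \in S, deg S v = 2 & w v = h.-1].
Proof. by rewrite inE => /andP[-> /andP[/eqP-> /eqP->]]. Qed.

Let heavyP a : a \in heavy -> a \in S /\ ~ (deg S a = 2 /\ w a = h.-1).
Proof.
by rewrite !inE => /andP[+ aS]; rewrite aS /= => na; split=> // -[d wa]; rewrite d wa !eqxx in na.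
Qed.

Let degAB t : deg S t = deg heavy t + deg light t.
Proof. by rewrite {1}eS degU. Qed.

Let lightk v : v \in light -> w v < k.
Proof. by case/lightP => _ _ ->; move: ek h0; clia. Qed.

(** A lighter [v] is deletable, since [12 (w v + 1) <= E + 3 + 6 w v] when [w v <= h - 2]. *)
Lemma deg2_weight v : v \in S -> deg S v = 2 -> h.-1 <= w v.
Proof.
move=> vS dv; rewrite leqNgt; apply/negP => wv.
have [x [y [[xy xS yS vx vy] _]]] := deg2P dv.
have c : cost k (w v) = 3 * w v by move: (costI (w v)) wv ek; clia.
apply: (delete_deg2 (d := 0) vS dv _ _ xy xS yS vx vy) => //.
- by move: wv ek; clia.
- by move: wv ek eE; clia.
- by rewrite addn0; apply: okS.
- rewrite c; move: (cost_diff (w x) (w v).+1) (cost_diff (w y) (w v).+1).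
  by move: wv ek eE; clia.
Qed.

Lemma light_indep : {in light &, forall u v, ~~ e u v}.
Proof.
move=> u v /lightP[uS du wu] /lightP[vS dv wv]; apply/negP => uv.
by apply: (delete_pair uS vS uv du dv); rewrite wu ?wv; move: ek eE h0; clia.
Qed.

Lemma light_nbr v z : v \in light -> z \in S -> e v z -> w z < k.
Proof.
move=> vB; have [vS dv wv] := lightP vB.
apply: (delete_big vS dv (lightk vB)); rewrite wv.
by move: ek eE h0; clia.
Qed.

Let degBB b : b \in light -> deg light b = 0.
Proof.
by move=> bB; rewrite /deg big1 // => t tB; rewrite (negbTE (light_indep bB tB)).
Qed.

Let degAb b : b \in light -> deg heavy b = 2.
Proof. by move=> bB; have [_ <- _] := lightP bB; rewrite degAB degBB ?addn0. Qed.

Let heavy_cases a : a \in heavy ->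
  [/\ deg S a = 1, k <= w a & deg light a = 0] \/
  (deg S a = 2 /\ h <= w a) \/ 3 <= deg S a.
Proof.
move=> aA; have [aS na] := heavyP aA.
have [d1|] := leqP (deg S a) 1.
  left; have [wa da] := deg_big aS d1; split=> //.
  rewrite /deg big1 // => b bB; apply/eqP; rewrite eqb0 e_sym; apply/negP => ba.
  by have := light_nbr bB aS ba; rewrite ltnNge wa.
rewrite leq_eqVlt => /orP[/eqP d2|]; last by right; right.
right; left; split=> //; have := deg2_weight aS (esym d2).
rewrite leq_eqVlt => /orP[/eqP wa|]; last by move: h0; clia.
by case: na.
Qed.

(** [I] consists of [P] and the light vertices without neighbors in [P]. The other light vertices
    have at most one neighbor in [F], and the hypotheses make [F] a matching. *)
Lemma color_heavy (P : {set T}) : P \subset heavy ->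
  {in P &, forall x y, ~~ e x y} ->
  {in heavy :\: P, forall a, w a < k} ->
  {in heavy :\: P, forall a,
     deg (heavy :\: P) a + deg [set b in light | 0 < deg P b] a <= 1} ->
  {in heavy :\: P &, forall a a', e a a' -> w a + w a' + 2 <= k} ->
  {in heavy :\: P, forall a b, b \in light -> 0 < deg P b -> e a b ->
     w a + h.-1 + 2 <= k} -> False.
Proof.
move=> sP iP wP dP wPP wPB; pose B' := [set b in light | 0 < deg P b].
have sB' : B' \subset light by apply/subsetP => b; rewrite inE => /andP[].
have dAB' : [disjoint heavy :\: P & B'].
  by apply: disjointWl (subsetDl _ _) (disjointWr sB' dAB).
apply: (@not_coloring (heavy :\: P :|: B')); split.
- by rewrite subUset (subset_trans (subsetDl _ _)) // (subset_trans sB').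
- have key t : t \in S :\: (heavy :\: P :|: B') ->
      t \in P \/ t \in light /\ deg P t = 0.
    rewrite in_setD in_setU negb_or eS in_setU => /andP[/andP[t1 t2]] /orP[tA|tB].
      by left; move: t1; rewrite in_setD tA andbT negbK.
    right; split=> //; apply/eqP; move: t2.
    by rewrite inE tB /= -leqNgt leqn0.
  move=> a b /key[aP|[aB da]] /key[bP|[bB db]].
  + exact: iP.
  + by rewrite e_sym (deg0 db aP).
  + by rewrite (deg0 da bP).
  + exact: light_indep.
have degB' b : b \in B' -> deg (heavy :\: P) b <= 1 /\ deg B' b = 0.
  move=> bB'; have bB := subsetP sB' b bB'.
  have := bB'; rewrite inE bB /= => d; split.
    have : deg heavy b = deg (heavy :\: P) b + deg P b.
      exact: degD.
    by rewrite degAb //; move: d; clia.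
  by apply/eqP; rewrite -leqn0 -(degBB bB); apply: deg_sub.
apply: good_matching => //.
- move=> t /setUP[tA|/(subsetP sB')]; [exact: wP | exact: lightk].
- move=> t /setUP[tA|tB]; rewrite degU //; first exact: dP.
  by have [d1 ->] := degB' t tB; rewrite addn0.
- move=> a b /setUP[aA|aB] /setUP[bA|bB] ab.
  + exact: wPP.
  + have := bB; rewrite inE => /andP[bL db].
    by have [_ _ ->] := lightP bL; apply: (wPB a aA b).
  + have := aB; rewrite inE => /andP[aL da]; rewrite e_sym in ab.
    by have [_ _ ->] := lightP aL; rewrite (addnC h.-1); apply: (wPB b bA a).
  + have [_ d] := degB' a aB; by rewrite (deg0 d bB) in ab.
Qed.

(* Twice the negated final charge, after every light vertex has sent
   [o.+1 / 2] to each of its two neighbors. *)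
Definition excess a :=
  E * deg S a + 3 + 2 * cost k (w a) - (3 * E + o.+1 * deg light a).

(** A light vertex gives away exactly its positive charge [o.+1] and ends at 0, so only heavy
    vertices remain in the sum. The premise keeps the subtraction in [excess] exact. *)
Lemma sum_excess :
  {in heavy, forall a, 3 * E + o.+1 * deg light a <= E * deg S a + 3 + 2 * cost k (w a)} ->
  \sum_(a in heavy) excess a + 2 * charges w S = 2 * (E * nedges S).
Proof.
move=> N0; have cAB : \sum_(a in heavy) deg light a = 2 * #|light|.
  have -> : \sum_(a in heavy) deg light a = cut light heavy by rewrite cutC.
  by rewrite /cut (eq_bigr (fun=> 2)) ?sum_nat_const 1?mulnC // => b /degAb.
have -> : 2 * (E * nedges S) = \sum_(x in S) E * deg S x.
  by rewrite -big_distrr /= -/(cut S S) nedgesE // mulnCA.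
have sl : 2 * charges w light = (2 * E + 2 * o.+1) * #|light|.
  rewrite /charges (eq_bigr (fun=> charge k h.-1)); last by move=> b /lightP[_ _ ->].
  rewrite sum_nat_const mulnA (mulnC 2) -mulnA mulnC; congr (_ * _).
  by move: (chargeE k2 h.-1) (costI h.-1) ek eE h0; clia.
have sld : \sum_(b in light) E * deg S b = 2 * E * #|light|.
  rewrite (eq_bigr (fun=> 2 * E)) ?sum_nat_const 1?mulnC // => b /lightP[_ -> _].
  by rewrite mulnC.
have sh : \sum_(a in heavy) E * deg S a =
    \sum_(a in heavy) excess a + 2 * charges w heavy + o.+1 * (2 * #|light|).
  rewrite -cAB /charges !big_distrr -!big_split /=; apply: eq_bigr => a aA.
  by move: (N0 a aA) (chargeE k2 (w a)); rewrite /excess; clia.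
have -> : charges w S = charges w heavy + charges w light by rewrite {1}eS chargesU.
rewrite [in RHS]eS sum_setU // -eS sh sld mulnDr sl.
by clear; lia.
Qed.

Let E5 : 5 <= E. Proof. exact: ecost_ge5. Qed.

Let deg_ge3E a : 3 <= deg S a -> exists m,
  [/\ deg S a = m + 3, E * deg S a = E * m + 3 * E & 5 * m <= E * m].
Proof.
move=> d; exists (deg S a - 3); split; first by rewrite subnK.
  by rewrite -[in LHS](subnK d) mulnDr (mulnC E 3).
by rewrite leq_mul2r E5 orbT.
Qed.

(** Weightless vertices of degree 3 are the tight ones. As [E] is odd, [excess a] and [deg heavy a]
    have the same parity, whence the jump by 2. A leaf of weight at least [k] has excess 3. *)
Lemma excess_even a : o = 0 -> a \in heavy ->
  (3 * E + o.+1 * deg light a <= E * deg S a + 3 + 2 * cost k (w a)) /\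
  (deg heavy a <= excess a) /\
  (excess a = deg heavy a -> w a = 0 /\ deg heavy a + deg light a = 3) /\
  (excess a <> deg heavy a -> deg heavy a + 2 <= excess a) /\
  (excess a <= 4 -> w a < k \/ excess a = 3 /\ deg heavy a = 1) /\
  (deg heavy a = 1 -> excess a = 3 -> deg light a <= 1).
Proof.
move=> o0 aA; rewrite /excess; move: (degAB a) (costI (w a)) eE ek h0.
have [[-> wa ->]|[[-> wa]|/deg_ge3E[m [-> -> hm]]]] := heavy_cases aA.
- by rewrite muln1 muln0; move: (cost_ge k2 wa) o0; clia.
- by rewrite o0; move: wa; clia.
- by rewrite o0; move: hm; clia.
Qed.

Lemma even_case : o = 0 -> False.
Proof.
move=> o0; have ev a := @excess_even a o0.
have sum4 : \sum_(a in heavy) excess a <= 4.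
  have := sum_excess (fun a aA => proj1 (ev a aA)); have := okS (subxx S).
  by clia.
have ex_le a : a \in heavy -> excess a + \sum_(t in heavy :\ a) excess t <= 4.
  by move=> aA; rewrite -big_setD1.
(* Each heavy neighbor of such a [p] has excess at least 1, which exhausts the total 4. All other
   heavy vertices are then tight and weightless, with no heavy neighbor but [p], and [p] goes to
   [I]. *)
have [/exists_inP[p pA /andP[hp np]]|/exists_inPn noP] :=
  boolP [exists p in heavy, (0 < deg heavy p) && (4 <= excess p + deg heavy p)].
  have [_ [n1 [n2 [n3 [_ n4]]]]] := ev p pA.
  have dp : deg heavy p = \sum_(t in heavy :\ p) e p t.
    by rewrite (degD1 _ pA) e_irr addn0.
  have inA t : t \in heavy :\ p -> t \in heavy by case/setD1P.
  have ge t : t \in heavy :\ p -> e p t <= deg heavy t <= excess t.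
    move=> tA; have [_ [-> _]] := ev t (inA t tA); rewrite andbT.
    case pt : (e p t) => //; apply/deg_gt0P; exists p; rewrite // e_sym //.
  have eq : {in heavy :\ p, forall t, excess t = e p t}.
    apply: sum_eq_pointwise => [t /ge/andP[]|]; first exact: leq_trans.
    by rewrite -dp; move: (ex_le p pA) np; clia.
  have sum_p : excess p + deg heavy p <= 4.
    by have := ex_le p pA; rewrite (eq_bigr _ eq) -dp.
  have dl : deg light p <= 1 by move: n1 n2 n3 n4 hp np sum_p; clia.
  have dt t : t \in heavy :\ p -> deg heavy t = e p t /\ w t = 0.
    move=> tA; have [_ [_ [z _]]] := ev t (inA t tA).
    have := ge t tA; rewrite eq // => /andP[l1 l2].
    have d : deg heavy t = e p t by apply/eqP; rewrite eqn_leq l1 l2.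
    by split=> //; apply: (proj1 (z _)); rewrite d eq.
  have d0 t : t \in heavy :\ p -> deg (heavy :\ p) t = 0.
    move=> tA; have [d _] := dt t tA.
    by move: d; rewrite (degD1 _ pA) e_sym; clia.
  apply: (@color_heavy [set p]); rewrite ?sub1set //.
  - by move=> x y /set1P-> /set1P->; rewrite e_irr.
  - by move=> t /dt[_ ->]; move: k2; clia.
  - move=> t tA; rewrite d0 // add0n; apply: leq_trans dl.
    rewrite [leqRHS]deg_card [leqLHS]deg_card; apply: subset_leq_card.
    by apply/subsetP => b; rewrite !inE deg1 lt0b e_sym => /andP[/andP[-> ->]].
  - by move=> t s /dt[_ ->] /dt[_ ->] _; move: k2; clia.
  - by move=> t /dt[_ ->] b _ _ _; move: ek h0; clia.
(* Without such a [p], heavy vertices induce a matching of weightless pairs and can all go to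
   [F]. *)
have dh a : a \in heavy -> deg heavy a <= 1 /\ (0 < deg heavy a -> w a = 0).
  move=> aA; have := noP a aA; have [_ [n1 [n2 [n3 _]]]] := ev a aA.
  by move: n1 n2 n3; clia.
apply: (@color_heavy set0); rewrite ?setD0 ?sub0set //.
- by move=> x y; rewrite inE.
- move=> a aA; have [_ [_ [_ [_ [n4 _]]]]] := ev a aA.
  have [_ w0] := dh a aA.
  have := n4 (leq_trans (leq_addr _ _) (ex_le a aA)).
  by move: w0 k2; clia.
- move=> a /dh[d _]; rewrite (_ : [set b in light | _] = set0).
    by rewrite [X in _ + X]/deg big_set0 addn0.
  by apply/setP => b; rewrite !inE /deg big_set0 andbF.
- move=> a b aA bA ab; have [_ wa] := dh a aA; have [_ wb] := dh b bA.
  rewrite wa ?wb; first by move: k2; clia.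
    by apply/deg_gt0P; exists a; rewrite // e_sym.
  by apply/deg_gt0P; exists b.
- by move=> a _ b _; rewrite /deg big_set0.
Qed.

(** Deleting [v] by [delete_deg2] falls short by exactly one unit, which a positive weight at a
    neighbor or a potential of [S] above [-2] would supply. *)
Lemma light_odd v : o = 1 -> v \in light ->
  (forall z, z \in S -> e v z -> w z = 0) /\ charges w S + 2 = E * nedges S.
Proof.
move=> o_1 vB; have [vS dv wv] := lightP vB.
have hv : 6 * (w v).+1 <= E + 3 by rewrite wv; move: ek eE h0; clia.
have cv : cost k (w v) = 3 * h.-1.
  by rewrite wv; move: (costI h.-1) ek h0; clia.
have step z : cost k (w z + (w v).+1) - cost k (w z) + (0 < w z) <= 3 * h.
  rewrite wv prednK //; move: (costI (w z)) (costI (w z + h)) ek h0 o_1.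
  by case: posnP; clia.
have [x [y [[xy xS yS vx vy] nxy]]] := deg2P dv.
have del d := @delete_deg2 v x y d vS dv (lightk vB) hv xy xS yS vx vy.
have exact : charges w S + 2 = E * nedges S.
  apply/eqP; rewrite eqn_leq (okS (subxx S)) andbT leqNgt; apply/negP => lt.
  apply: (del 1) => //; first by move: lt; clia.
  by rewrite cv; move: (step x) (step y) eE ek h0 o_1; clia.
split=> // z zS vz; apply/eqP; rewrite -leqn0 leqNgt; apply/negP => wz.
apply: (del 0) => //; first by rewrite addn0 okS.
have zxy : z = x \/ z = y.
  have [->|zx] := eqVneq z x; first by left.
  have [->|zy] := eqVneq z y; first by right.
  by rewrite nxy in vz.
have : (0 < w x) || (0 < w y) by case: zxy => <-; rewrite wz ?orbT.
rewrite cv; move: (step x) (step y) eE ek h0 o_1.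
by case: (0 < w x); case: (0 < w y) => //=; clia.
Qed.

Lemma heavy_odd a : o = 1 -> a \in heavy ->
  (0 < w a -> deg light a = 0) /\ (deg S a = 3 -> deg light a <= 1).
Proof.
move=> o_1 aA; have [aS _] := heavyP aA.
have pos : 0 < deg light a -> w a = 0.
  case/deg_gt0P => v vB av; have [w0 _] := light_odd o_1 vB.
  by apply: w0; rewrite // e_sym.
split; first by case: (posnP (deg light a)) => // /pos->.
move=> d3; rewrite leqNgt; apply/negP => d2.
have wa : w a = 0 by apply: pos; move: d2; clia.
have [v vB av] := deg_gt0P _ _ (ltnW d2).
have [v' v'B av'] : exists2 v', v' \in light :\ v & e a v'.
  by apply/deg_gt0P; move: d2; rewrite (degD1 _ vB) av; clia.
have /setD1P[vv' vB'] := v'B.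
have [vS dv wv] := lightP vB; have [vS' dv' wv'] := lightP vB'.
apply: (delete_star aS vS vS' av av' _ _ wa wv wv' d3 dv dv').
- by rewrite eq_sym.
- exact: light_indep.
- by move: ek h0 o_1; clia.
- by move: eE ek h0; clia.
- by move: (costI h.-1) ek h0; clia.
Qed.

(** The outcomes come, in order, from degree 3 with one light neighbor, degree 2 with weight [h],
    degree 3 with heavy neighbors only, leaves of weight at least [k], and weightless vertices of
    degree 4. *)
Lemma excess_odd a : o = 1 -> a \in heavy ->
  (3 * E + o.+1 * deg light a <= E * deg S a + 3 + 2 * cost k (w a)) /\
  (0 < excess a) /\
  (excess a <= 4 ->
     excess a = 1 /\ deg heavy a = 2 /\ deg light a = 1 /\ w a = 0 \/
     excess a = 2 /\ deg heavy a = 2 /\ deg light a = 0 /\ w a < k \/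
     excess a = 3 /\ deg heavy a = 3 \/
     excess a = 3 /\ deg heavy a = 1 \/
     2 * deg heavy a + 2 <= excess a /\ w a = 0).
Proof.
move=> o_1 aA; have [l0 l1] := heavy_odd o_1 aA.
have E7 : 7 <= E by move: eE ek h0 o_1; clia.
rewrite /excess; move: l0 l1 (degAB a) (costI (w a)) eE ek h0.
have [[-> wa ->]|[[-> wa]|d3]] := heavy_cases aA.
- by rewrite muln1 muln0; move: (cost_ge k2 wa) o_1; clia.
- move=> l0 _; have w0 : 0 < w a by move: wa h0; clia.
  by rewrite (l0 w0) o_1; move: wa w0; clia.
- have [m [-> -> _]] := deg_ge3E d3.
  have hm : 7 * m <= E * m by rewrite leq_mul2r E7 orbT.
  by rewrite o_1; move: hm; clia.
Qed.

Lemma odd_case : o = 1 -> False.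
Proof.
move=> o_1; have od a := @excess_odd a o_1.
have sumE := sum_excess (fun a aA => proj1 (od a aA)).
have sum4 : \sum_(a in heavy) excess a <= 4.
  by move: sumE (okS (subxx S)); clia.
have n1 a : a \in heavy -> 0 < excess a by case/od => _ [].
have n4 a : a \in heavy -> excess a <= 4.
  move=> aA; apply: leq_trans sum4; rewrite (big_setD1 a) //; exact: leq_addr.
have cases a (aA : a \in heavy) := proj2 (proj2 (od a aA)) (n4 a aA).
have deg_sum (X : {set T}) t : X \subset heavy -> deg X t <= \sum_(a in X) excess a.
  move=> sX; apply: leq_sum => a aX; have := n1 a (subsetP sX a aX).
  by case: (e t a).
have sum0 (X : {set T}) : X \subset heavy -> \sum_(a in X) excess a = 0 -> X = set0.
  move=> sX s0; apply/eqP; rewrite -subset0; apply/subsetP => a aX.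
  have := n1 a (subsetP sX a aX); rewrite lt0n; case/negP.
  by move/eqP: s0; rewrite (big_setD1 a) //= addn_eq0 => /andP[].
have [/exists_inP[a0 a0A ha0]|/exists_inPn no] :=
  boolP [exists a in heavy, 0 < deg heavy a]; last first.
  have d0 a : a \in heavy -> deg heavy a = 0.
    by move=> /no; rewrite lt0n negbK => /eqP.
  apply: (@color_heavy set0); rewrite ?setD0 ?sub0set //.
  - by move=> x y; rewrite inE.
  - by move=> a aA; move: (cases a aA) (d0 a aA) k2; clia.
  - move=> a aA; rewrite d0 // (_ : [set b in light | _] = set0).
      by rewrite /deg big_set0.
    by apply/setP => b; rewrite !inE /deg big_set0 andbF.
  - by move=> a b aA bA; rewrite (deg0 (d0 a aA)).
  - by move=> a _ b _; rewrite /deg big_set0.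
have split1 (X : {set T}) a : a \in X ->
  \sum_(t in X) excess t = excess a + \sum_(t in X :\ a) excess t.
  by move=> aX; rewrite (big_setD1 a).
have sD (X : {set T}) a : X \subset heavy -> X :\ a \subset heavy.
  by apply: subset_trans; apply: subsetDl.
(* All excesses are positive with sum at most 4, which excludes the last three outcomes. Beside a
   leaf of excess 3, its neighbor would have excess 1 and hence a second heavy neighbor. *)
have cls a : a \in heavy -> 0 < deg heavy a -> deg heavy a = 2 /\
    (excess a = 1 /\ deg light a = 1 /\ w a = 0 \/ excess a = 2 /\ deg light a = 0).
  move=> aA ha; have da := degD1 a aA; rewrite e_irr addn0 in da.
  have := split1 _ a aA; have := deg_sum _ a (sD _ a (subxx heavy)).
  rewrite -da => d1 s1; have [[? [? [? ?]]]|[[? [? [? ?]]]|[[n3 h3]|[[na ha1]|[n3 h3]]]]] := cases a aA.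
  - by split=> //; left.
  - by split=> //; right.
  - by exfalso; move: d1 s1 sum4 ha n3 h3; clia.
  - exfalso; have [q qA aq] := deg_gt0P _ _ ha.
    have qA' : q \in heavy :\ a.
      by rewrite in_setD1 qA andbT; apply: contraTneq aq => ->; rewrite e_irr.
    have sq := split1 _ q qA'; have nq := n1 q qA.
    have dq := deg_sum _ q (sD _ q (sD _ a (subxx heavy))).
    have : deg heavy q <= 1.
      rewrite (degD1 _ aA) (degD1 _ qA') e_irr.
      by move: sq nq dq s1 sum4 na; case: (e q a); clia.
    by move: (cases q qA) sq nq s1 sum4 na; clia.
  - by exfalso; move: d1 s1 sum4 ha n3 h3; clia.
have nbr3 a : a \in heavy -> 0 < deg heavy a -> exists p q,
    [/\ p \in heavy :\ a, q \in heavy :\ a :\ p, e a p, e a q &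
     {in heavy, forall t, t != p -> t != q -> e a t = false}].
  move=> aA ha; have [d2 _] := cls a aA ha.
  have [p [q [[pq pA qA ap aq] npq]]] := deg2P d2; exists p, q; split=> //.
    by rewrite in_setD1 pA andbT; apply: contraTneq ap => ->; rewrite e_irr.
  rewrite !in_setD1 qA andbT eq_sym pq /=.
  by apply: contraTneq aq => ->; rewrite e_irr.
have hpos a t : a \in heavy -> e t a -> 0 < deg heavy t.
  by move=> aA ta; apply/deg_gt0P; exists a.
(* With excess 2 at [a], its two heavy neighbors complete the total 4, so there are no further heavy
   vertices and [a] goes to [I]. *)
have [/exists_inP[a aA /andP[ha /eqP na]]|/exists_inPn no2] :=
  boolP [exists a in heavy, (0 < deg heavy a) && (excess a == 2)].
  have [p [q [pA qA ap aq _]]] := nbr3 a aA ha.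
  have [d2 da] := cls a aA ha; have la : deg light a = 0 by move: da na; clia.
  have pA1 : p \in heavy by case/setD1P: pA.
  have qA2 : q \in heavy :\ a by case/setD1P: qA.
  have qA1 : q \in heavy by case/setD1P: qA2.
  have s1 := split1 _ a aA; have s2 := split1 _ p pA; have s3 := split1 _ q qA.
  have np := n1 p pA1; have nq := n1 q qA1.
  have r0 : heavy :\ a :\ p :\ q = set0.
    apply: sum0; first by rewrite !sD.
    by move: s1 s2 s3 np nq na sum4; clia.
  have inpq t : t \in heavy :\ a -> t = p \/ t = q.
    move=> tA; have [->|tp] := eqVneq t p; first by left.
    have [->|tq] := eqVneq t q; first by right.
    have : t \in heavy :\ a :\ p :\ q by rewrite in_setD1 tq in_setD1 tp.
    by rewrite r0 inE.
  have prop t : t \in heavy :\ a -> [/\ e t a, deg heavy t = 2 & w t = 0].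
    move=> tA; have ta : e t a by case: (inpq t tA) => ->; rewrite e_sym.
    have tA1 : t \in heavy by case/setD1P: tA.
    have nt : excess t = 1.
      by case: (inpq t tA) => ->; move: s1 s2 s3 np nq na sum4; clia.
    by have [dt ct] := cls t tA1 (hpos a t aA ta); split=> //; move: ct nt; clia.
  apply: (@color_heavy [set a]); rewrite ?sub1set //.
  - by move=> x y /set1P-> /set1P->; rewrite e_irr.
  - by move=> t /prop[_ _ ->]; move: k2; clia.
  - move=> t /prop[ta dt _]; rewrite (_ : [set b in light | _] = set0).
      rewrite [X in _ + X]/deg big_set0 addn0.
      by move: dt; rewrite (degD1 _ aA) ta; clia.
    apply/setP => b; rewrite in_set in_set0 deg1 lt0b e_sym.
    by apply/negP => /andP[bB]; rewrite (deg0 la bB).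
  - by move=> t s /prop[_ _ ->] /prop[_ _ ->] _; move: k2; clia.
  - move=> t _ b bB; rewrite deg1 lt0b e_sym (deg0 la bB) //.
have cls1 a : a \in heavy -> 0 < deg heavy a ->
    [/\ deg heavy a = 2, excess a = 1, deg light a = 1 & w a = 0].
  move=> aA ha; have := no2 a aA; rewrite ha /= => /eqP na2.
  by have [d [[? [? ?]]|[? _]]] := cls a aA ha.
have [p [q [pA qA ap aq npq]]] := nbr3 a0 a0A ha0.
have pA1 : p \in heavy by case/setD1P: pA.
have qA2 : q \in heavy :\ a0 by case/setD1P: qA.
have qA1 : q \in heavy by case/setD1P: qA2.
have pa : e p a0 by rewrite e_sym.
have qa : e q a0 by rewrite e_sym.
have [da na la wa] := cls1 a0 a0A ha0.
have [dp np lp wp] := cls1 p pA1 (hpos a0 p a0A pa).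
have [dq nq lq wq] := cls1 q qA1 (hpos a0 q a0A qa).
have s1 := split1 _ a0 a0A; have s2 := split1 _ p pA; have s3 := split1 _ q qA.
(* A light neighbor makes the potential of [S] exactly [-2], so a fourth heavy vertex [r] exists.
   The heavy vertices form a 4-cycle, and the opposite corners [a0], [r] go to [I]. *)
have sumeq : \sum_(a in heavy) excess a = 4.
  have [b bB _] : exists2 b, b \in light & e a0 b by apply/deg_gt0P; rewrite la.
  by have [_ exact] := light_odd o_1 bB; move: sumE exact; clia.
have [r rR] : exists r, r \in heavy :\ a0 :\ p :\ q.
  apply/set0Pn; apply/eqP => r0; move: s1 s2 s3; rewrite r0 big_set0.
  by move: na np nq sumeq; clia.
have s4 := split1 _ r rR.
have /setD1P[rq /setD1P[rp /setD1P[ra rA]]] := rR.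
have nr : excess r = 1 by move: (n1 r rA) s1 s2 s3 s4 na np nq sumeq; clia.
have dr : deg heavy r = 2 by move: (cases r rA) nr; clia.
have r0 : heavy :\ a0 :\ p :\ q :\ r = set0.
  by apply: sum0; rewrite ?sD //; move: s1 s2 s3 s4 na np nq nr sumeq; clia.
have ar : e a0 r = false by apply: npq.
have [rp1 rq1] : e r p /\ e r q.
  have : deg (heavy :\ a0 :\ p :\ q :\ r) r = 0 by rewrite r0 /deg big_set0.
  move: dr; rewrite (degD1 _ a0A) (degD1 _ pA) (degD1 _ qA) (degD1 _ rR).
  by rewrite e_irr (e_sym r a0) ar; case: (e r p); case: (e r q); clia.
pose P := [set a0; r].
have sP : P \subset heavy by apply/subsetP => t /set2P[->|->].
have da0r : [disjoint [set a0] & [set r]] by rewrite disjoints1 inE eq_sym.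
have inpq t : t \in heavy :\: P -> t = p \/ t = q.
  move=> /setDP[tA]; rewrite !inE negb_or => /andP[ta tr].
  have [->|tp] := eqVneq t p; first by left.
  have [->|tq] := eqVneq t q; first by right.
  have : t \in heavy :\ a0 :\ p :\ q :\ r.
    by rewrite in_setD1 tr in_setD1 tq in_setD1 tp in_setD1 ta.
  by rewrite r0 inE.
have prop t : t \in heavy :\: P ->
    [/\ deg (heavy :\: P) t = 0, deg light t = 1 & w t = 0].
  move=> tA; have [ta tr] : e t a0 /\ e t r.
    by case: (inpq t tA) => ->; rewrite ?pa ?qa e_sym.
  have [dt lt wt] : [/\ deg heavy t = 2, deg light t = 1 & w t = 0].
    by case: (inpq t tA) => ->.
  split=> //; move: dt; rewrite (degD _ sP) [X in _ + X]degU // !deg1 ta tr.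
  by clia.
apply: (@color_heavy P) => //.
- move=> x y /set2P[->|->] /set2P[->|->]; rewrite ?e_irr ?ar //.
  by rewrite e_sym ar.
- by move=> t /prop[_ _ ->]; move: k2; clia.
- move=> t /prop[-> lt _]; rewrite add0n -lt; apply: deg_sub.
  by apply/subsetP => b; rewrite inE => /andP[].
- by move=> t s /prop[_ _ ->] /prop[_ _ ->] _; move: k2; clia.
- by move=> t /prop[_ _ ->] b _ _ _; move: ek h0; clia.
Qed.
End Endgame.
End Minimal.

Lemma ok_colorable w S : ok w S -> colorable w S.
Proof.
have [n] := ubnP (weight_gap w S); elim: n w S => // n IHn w S hn okS.
apply: NNPP => ncol; have [h [o [ek o1 h0]]] := halfP k2.
have IH (w' : T -> nat) (S' : {set T}) : weight_gap w' S' < weight_gap w S ->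
    ok w' S' -> colorable w' S'.
  by move=> lt; apply: IHn; apply: leq_trans lt _.
case: o o1 ek => [|[|//]] o1 ek.
  exact: (even_case okS IH ncol ek o1 h0).
exact: (odd_case okS IH ncol ek o1 h0).
Qed.
End Potential.

(** * From weighted graphs to [mad] *)

Section Graph.
Variable G : sgraph.
Local Notation e := (@adj G).

(** Each component lies within one class of the labelling, where every vertex of weight 0 counts
    1. *)
Lemma good_IF_coloring k (F : {set G}) :
  {in ~: F &, forall x y, ~~ e x y} -> good e k (fun=> 0) F ->
  is_IF_coloring k (~: F) F.
Proof.
move=> iF [sF [r [r1 r2]]]; split.
- by rewrite setUC setUCr.
- by rewrite disjoint_sym disjoints_subset setCK.
- by move=> x y xI yI; apply: iF.
- move=> c uc; rewrite -(size_map val).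
  apply: (sparse_ucycle (@adj_sym G) (@adj_irrefl G) sF).
    by move=> x /mapP[y _ ->]; apply: (valP y).
  move: uc => /andP[cyc uc]; rewrite /ucycle map_inj_uniq ?uc ?andbT //; last exact: val_inj.
  by case: c cyc {uc} => //= x c; rewrite -map_rcons path_map.
- move=> x; apply: leq_trans (r2 (val x) (valP x)).
  rewrite -(card_imset _ val_inj) sum1dep_card; apply: subset_leq_card.
  apply/subsetP => _ /imsetP[y + ->]; rewrite !inE => /connectP[p + ->].
  rewrite (valP (last x p)) /=.
  elim: p x => [|z p IH] x //= /andP[xz /IH/eqP->].
  by rewrite (r1 (val x) (val z)) // ; apply: valP.
Qed.

(** Ordered adjacent pairs are grouped by their underlying edge; a group has at most the two members
    [(x, y)] and [(y, x)]. *)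
Lemma nedges_edges (A : {set G}) :
  nedges e A <= #|[set s in edges G | s \subset A]|.
Proof.
suff : cut e A A <= 2 * #|[set s in edges G | s \subset A]|.
  by rewrite nedgesE; [lia | exact: adj_sym | exact: adj_irrefl].
pose D := [set p : G * G | [&& p.1 \in A, p.2 \in A & e p.1 p.2]].
have -> : cut e A A = #|D|.
  rewrite /cut /deg pair_big_dep /= -sum1_card big_mkcond [RHS]big_mkcond.
  apply: eq_bigr => -[x y] _; rewrite !inE /=.
  by case: (x \in A); case: (y \in A) => //=; case: (adj x y).
rewrite -sum1_card (partition_big (fun p => [set p.1; p.2])
  (mem [set s in edges G | s \subset A])) /=; last first.
  move=> [x y]; rewrite !inE /= => /and3P[xA yA xy].
  rewrite subUset !sub1set xA yA !andbT; by apply/imsetP; exists (x, y); rewrite ?inE.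
rewrite mulnC -sum_nat_const; apply: leq_sum => s _.
have [/existsP[[x y] /andP[_ /eqP es]]|/existsPn no] :=
  boolP [exists p, (p \in D) && ([set p.1; p.2] == s)]; last first.
  by rewrite big_pred0 // => p; apply/negbTE/no.
apply: (@leq_trans #|[set (x, y); (y, x)]|); last by rewrite cards2; case: eqP.
rewrite sum1dep_card; apply: subset_leq_card; apply/subsetP => -[a b].
rewrite !inE /= -es => /andP[/and3P[_ _ ab] /eqP eab].
have nab : a != b by apply: contraTneq ab => ->; rewrite adj_irrefl.
have : a \in [set x; y] by rewrite -eab !inE eqxx.
have : b \in [set x; y] by rewrite -eab !inE eqxx orbT.
rewrite !inE !xpair_eqE => /orP[/eqP eb|/eqP eb] /orP[/eqP ea|/eqP ea];
  by move: nab; rewrite ea eb ?eqxx ?orbT.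
Qed.

Import Order.TTheory GRing.Theory Num.Theory.
Local Open Scope ring_scope.

Lemma f_ecost k : (2 <= k)%N -> f k = 3 - 3 / (ecost k)%:R.
Proof.
move=> k2; have [h [o [ek o1 h0]]] := halfP k2; have := ecostP k2 ek o1 h0.
have ko : odd k = (o == 1)%N by rewrite ek oddD odd_double; case: o o1 {ek} => [|[]].
rewrite /f ko => eE; have : (ecost k)%:R + 1 + o%:R = 3 * k%:R :> rat.
  by rewrite -natrM -eE !natrD.
case: o o1 {ek eE ko} => [|[|//]] _ /= <-; first by rewrite addr0 addrK.
by congr (3 - 3 / _); rewrite -(addrA _%:R) addrK.
Qed.

(** The average degree bound for the subgraph induced on [A], multiplied by [E #|A|], says that [A]
    has nonnegative potential. *)
Lemma mad_ok k : (2 <= k)%N -> mad G <= f k ->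
  ok e k (fun=> 0%N) [set: G].
Proof.
move=> k2 hm A _; have [->|A0] := eqVneq A set0; first by rewrite nedges0 muln0.
pose EA := [set s in edges G | s \subset A].
have avg : average_degree (A, EA) <= f k.
  apply: le_trans hm; rewrite /mad.
  apply: (@le_bigmax_cond _ _ _ 0 (A, EA)).
  rewrite A0 andbT /is_subgraph /=; apply/andP; split.
    by apply/subsetP => s; rewrite inE => /andP[].
  by apply/forall_inP => s; rewrite inE => /andP[].
have cA : (0 < #|A|%:R :> rat) by rewrite ltr0n card_gt0.
have E5 := ecost_ge5 k2.
have E0 : (0 < (ecost k)%:R :> rat) by rewrite ltr0n; lia.
move: avg; rewrite f_ecost // /average_degree ler_pdivrMr //= => avg.
have : 2 * (ecost k)%:R * #|EA|%:R <= (3 * (ecost k)%:R - 3) * #|A|%:R :> rat.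
  rewrite [2 * _]mulrC -mulrA; apply: le_trans (ler_wpM2l (ltW E0) avg) _.
  by rewrite mulrA mulrBr mulrCA divff ?gt_eqF // mulr1 mulrC [_ * 3]mulrC mulrC.
have -> : 3 * (ecost k)%:R - 3 = (2 * charge k 0)%:R :> rat.
  apply/eqP; rewrite subr_eq -!natrM -natrD eqr_nat; apply/eqP.
  by have := chargeE k2 0; rewrite cost0 //; lia.
rewrite -!natrM ler_nat => hE.
have hn := leq_mul (leqnn (ecost k)) (nedges_edges A).
by rewrite /charges sum_nat_const; move: hE hn; rewrite -/EA; clear; lia.
Qed.
End Graph.

Theorem theorem1 (k : nat) (G : sgraph) :
  (2 <= k)%N -> (mad G <= f k)%R -> has_IF_coloring k G.
Proof.
move=> k2 /(mad_ok k2)/(ok_colorable (@adj_sym G) (@adj_irrefl G) k2)[F _ [iF gF]].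
by exists (~: F), F; apply: good_IF_coloring gF; rewrite -setTD.
Qed.
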